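(* Consider the setting, notation and asynchronous update (U) described in the context. Assume: (1) for each $i\in\mathcal V$, $f_i$ and $h_i$ are proper, closed and convex, and $f_i$ is differentiable; (2) the network $\mathcal G$ is undirected and connected; (3) for each $i\in\mathcal V$ the functions $m_i^k$ used in (U) are convex, and there is $\beta_i\ge 0$ such that for all $x_i\in\mathbb R^d$ and all $k$ $$m_i^k(x_i)\le f_i(x_i)\le m_i^k(x_i)+\frac{\beta_i}{2}\|x_i-x_i^k\|^2;$$ (4) problem (P) in the context has an optimal solution. Let $\mathbf x^\star=((x_1^\star)^T,\dots,(x_n^\star)^T)^T$ be an arbitrary optimal solution of (P), and let $\{\mathbf x^k\}$ be generated by (U). Suppose that for all $i\in\mathcal V$ and $k\in\mathbb N_0$ $$\gamma_i^k=\gamma_i\in\left(0,\frac{1}{\beta_i+\frac{1-w_{ii}}{\alpha}}\right).$$ Then: 1) Under partial asynchrony (with constants $B,D$), $\{\mathbf x^k\}$ converges to an optimal solution of (P). If, in addition, each $\phi_i=f_i+h_i$ is $\theta_i$-strongly convex for some $\theta_i>0$, then for all $i\in\mathcal V$ and $k\in\mathbb N_0$ $$\|x_i^k-x_i^\star\|^2\le \rho^{\lfloor k/(B+D+1)\rfloor}\max_{j\in\mathcal V}\|x_j^0-x_j^\star\|^2,\qquad \rho=\frac{1}{1+\min_{i\in\mathcal V}\gamma_i\theta_i}\in(0,1).$$ 2) Under total asynchrony, if each $\phi_i$ is $\theta_i$-strongly convex for some $\theta_i>0$, then $\{\mathbf x^k\}$ converges to an optimal solution of (P).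
   Context: $\mathbb N_0=\{0,1,2,\dots\}$. $\mathcal G=(\mathcal V,\mathcal E)$ is a network with $\mathcal V=\{1,\dots,n\}$, and $\mathcal N_i=\{j:\{i,j\}\in\mathcal E\}$ is the neighbor set of node $i$ (not containing $i$). Each node $i$ has functions $f_i:\mathbb R^d\to\mathbb R$ and $h_i:\mathbb R^d\to\mathbb R\cup\{+\infty\}$; $\phi_i=f_i+h_i$. $W=(w_{ij})\in\mathbb R^{n\times n}$ is an averaging matrix associated with $\mathcal G$: symmetric, doubly stochastic, $w_{ij}>0$ if $j\in\mathcal N_i\cup\{i\}$ and $w_{ij}=0$ otherwise. $\mathbf W=W\otimes I_d$, and $\alpha>0$ is a fixed parameter. Write $\mathbf x=(x_1^T,\dots,x_n^T)^T\in\mathbb R^{nd}$. Problem (P): minimize over $\mathbf x\in\mathbb R^{nd}$ the function $\sum_{i=1}^n f_i(x_i)+\sum_{i=1}^n h_i(x_i)+\frac{1}{2\alpha}\mathbf x^T(I-\mathbf W)\mathbf x$. Asynchronous update (U): $\mathcal K_i\subseteq\mathbb N_0$ is the set of iterations at which node $i$ updates. For $k\in\mathcal K_i$ and $j\in\mathcal N_i$, $s_{ij}^k\in\{0,\dots,k\}$ is the iteration index of the most recent $x_j$ available to node $i$, and $s_{ii}^k=k$. Starting from any $\mathbf x^0\in\mathbb R^{nd}$, for $k\in\mathcal K_i$, $$x_i^{k+1}=\arg\min_{x_i\in\mathbb R^d}\; m_i^k(x_i)+h_i(x_i)+\frac{\|x_i-x_i^k\|^2}{2\gamma_i^k}+\frac1\alpha\Big\langle\sum_{j\in\mathcal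 N_i}w_{ij}(x_i^k-x_j^{s_{ij}^k}),x_i\Big\rangle,$$ where $m_i^k:\mathbb R^d\to\mathbb R$ is a model of $f_i$ and $\gamma_i^k>0$ is a step-size; for $k\notin\mathcal K_i$, $x_i^{k+1}=x_i^k$. Partial asynchrony: there exist non-negative integers $B,D$ such that (i) for every $i\in\mathcal V$ and $k\in\mathbb N_0$ at least one element of $\{k,\dots,k+B\}$ belongs to $\mathcal K_i$; (ii) $k-D\le s_{ij}^k\le k$ for all $i\in\mathcal V$, $j\in\mathcal N_i$, $k\in\mathcal K_i$. Total asynchrony: (i) each $\mathcal K_i$ is an infinite subset of $\mathbb N_0$; (ii) $\lim_{k\to+\infty}s_{ij}^k=+\infty$ (along $k\in\mathcal K_i$) for all $i\in\mathcal V$, $j\in\mathcal N_i$. A convex function $\phi$ is $\mu$-strongly convex if $\phi(y)-\phi(x)-\langle g,y-x\rangle\ge\frac\mu2\|y-x\|^2$ for all $x,y\in\mathbb R^d$ and all $g\in\partial\phi(x)$. $\|\cdot\|$ is the Euclidean norm. *)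

(* Defs.v *)
From HB Require Import structures.
From mathcomp Require Import all_boot all_order all_algebra.
From mathcomp Require Import all_classical all_reals all_analysis.
From mathcomp Require Import mxtens.

Set Implicit Arguments.
Unset Strict Implicit.
Unset Printing Implicit Defensive.

Import Order.TTheory GRing.Theory Num.Theory.
Import numFieldNormedType.Exports.

Local Open Scope classical_set_scope.
Local Open Scope ring_scope.

(* The norm `|u| of 'rV[R]_d is the max norm, hence a separate Euclidean norm.
   Both induce the product topology used for limits, closedness and
   differentiability. *)
Definition dot {R : realType} {d : nat} (u v : 'rV[R]_d) : R :=
  (u *m v^T) 0 0.

Definition enorm {R : realType} {d : nat} (u : 'rV[R]_d) : R :=
  Num.sqrt (dot u u).

(* Real-valued functions are fed to the next definitions through EFin. *)
Definition proper_fun {R : realType} {d : nat} (phi : 'rV[R]_d -> \bar R) :=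
  (forall x, phi x != -oo%E) /\ (exists x, phi x != +oo%E).

Definition closed_fun {R : realType} {d : nat} (phi : 'rV[R]_d -> \bar R) :=
  closed [set p : 'rV[R]_d * R | (phi p.1 <= p.2%:E)%E].

(* Meant for functions that do not take the value -oo. The convention
   0 * +oo = 0 is harmless: at t = 0 and t = 1 the inequality is trivial. *)
Definition cvx_fun {R : realType} {d : nat} (phi : 'rV[R]_d -> \bar R) :=
  forall (x y : 'rV[R]_d) (t : R), 0 <= t <= 1 ->
    (phi (t *: x + (1 - t) *: y)%R <= t%:E * phi x + (1 - t)%:E * phi y)%E.

Definition proper_closed_convex {R : realType} {d : nat}
    (phi : 'rV[R]_d -> \bar R) :=
  [/\ proper_fun phi, closed_fun phi & cvx_fun phi].

(* For a proper phi this is empty wherever phi x = +oo. *)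
Definition subdiff {R : realType} {d : nat} (phi : 'rV[R]_d -> \bar R)
    (x : 'rV[R]_d) : set 'rV[R]_d :=
  [set g | forall y, (phi x + (dot g (y - x))%:E <= phi y)%E].

Definition strongly_convex {R : realType} {d : nat} (mu : R)
    (phi : 'rV[R]_d -> \bar R) :=
  cvx_fun phi /\
  forall x y g, subdiff phi x g ->
    ((mu / 2 * enorm (y - x) ^+ 2)%:E <= phi y - phi x - (dot g (y - x))%:E)%E.

Definition argmin {R : realType} {T : Type} (F : T -> \bar R) : set T :=
  [set x | forall y, (F x <= F y)%E].

(* Minimum of a nonempty finite family. *)
Definition minf {R : realType} {n : nat} (F : 'I_n.+1 -> R) : R :=
  \big[Num.min/F ord0]_(i < n.+1) F i.

(* A network on n nodes is its adjacency relation e; j is in N_i iff e i j. *)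
Definition network {n : nat} (e : rel 'I_n) := symmetric e /\ irreflexive e.

Definition connected_network {n : nat} (e : rel 'I_n) :=
  forall i j, connect e i j.

Definition doubly_stochastic {R : realType} {n : nat} (W : 'M[R]_n) :=
  [/\ forall i j, 0 <= W i j,
      forall i, \sum_j W i j = 1 & forall j, \sum_i W i j = 1].

Definition averaging_matrix {R : realType} {n : nat} (e : rel 'I_n)
    (W : 'M[R]_n) :=
  [/\ W^T = W, doubly_stochastic W,
      forall i j, e i j || (j == i) -> 0 < W i j &
      forall i j, ~~ (e i j || (j == i)) -> W i j = 0].

(* A point of R^(nd) is stored as the n x d matrix whose i-th row is the block
   x_i; stack turns it into the column vector (x_1^T, ..., x_n^T)^T, with the
   index convention of the Kronecker product *t. *)
Definition stack {R : realType} {n d : nat} (x : 'M[R]_(n, d)) :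
    'cV[R]_(n * d) :=
  \col_p x (mxtens_unindex p).1 (mxtens_unindex p).2.

Definition laplacian_form {R : realType} {n d : nat} (W : 'M[R]_n)
    (x : 'M[R]_(n, d)) : R :=
  ((stack x)^T *m (1%:M - W *t (1%:M : 'M[R]_d)) *m stack x) 0 0.

Definition objective {R : realType} {n d : nat} (f : 'I_n -> 'rV[R]_d -> R)
    (h : 'I_n -> 'rV[R]_d -> \bar R) (W : 'M[R]_n) (alpha : R)
    (x : 'M[R]_(n, d)) : \bar R :=
  (\sum_(i < n) (f i (row i x))%:E + \sum_(i < n) h i (row i x)
   + ((2 * alpha)^-1 * laplacian_form W x)%:E)%E.

Definition optimal {R : realType} {n d : nat} (f : 'I_n -> 'rV[R]_d -> R)
    (h : 'I_n -> 'rV[R]_d -> \bar R) (W : 'M[R]_n) (alpha : R) :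
    set 'M[R]_(n, d) :=
  argmin (objective f h W alpha).

(* s i j k is the index s_{ij}^k; only its values at k in K i matter. *)
Definition valid_delays {n : nat} (e : rel 'I_n) (K : 'I_n -> set nat)
    (s : 'I_n -> 'I_n -> nat -> nat) :=
  forall i k, K i k -> s i i k = k /\ forall j, e i j -> (s i j k <= k)%N.

Definition local_objective {R : realType} {n d : nat} (e : rel 'I_n)
    (h : 'I_n -> 'rV[R]_d -> \bar R) (W : 'M[R]_n) (alpha : R)
    (m : 'I_n -> nat -> 'rV[R]_d -> R) (gamma : 'I_n -> nat -> R)
    (s : 'I_n -> 'I_n -> nat -> nat) (x : nat -> 'M[R]_(n, d))
    (i : 'I_n) (k : nat) (z : 'rV[R]_d) : \bar R :=
  ((m i k z)%:E + h i z
   + (enorm (z - row i (x k)) ^+ 2 / (2 * gamma i k))%:E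
   + (alpha^-1 *
      dot (\sum_(j < n | e i j) W i j *: (row i (x k) - row j (x (s i j k))))
          z)%:E)%E.

(* The local objective is strongly convex, so it has at most one minimizer and
   membership in argmin means equality with it. *)
Definition async_iterates {R : realType} {n d : nat} (e : rel 'I_n)
    (h : 'I_n -> 'rV[R]_d -> \bar R) (W : 'M[R]_n) (alpha : R)
    (m : 'I_n -> nat -> 'rV[R]_d -> R) (gamma : 'I_n -> nat -> R)
    (K : 'I_n -> set nat) (s : 'I_n -> 'I_n -> nat -> nat)
    (x : nat -> 'M[R]_(n, d)) :=
  forall i k,
    (K i k ->
       argmin (local_objective e h W alpha m gamma s x i k)
              (row i (x k.+1))) /\
    (~ K i k -> row i (x k.+1) = row i (x k)).

Definition partially_asynchronous {n : nat} (e : rel 'I_n)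
    (K : 'I_n -> set nat) (s : 'I_n -> 'I_n -> nat -> nat) (B D : nat) :=
  (forall i k, exists2 t, (k <= t <= k + B)%N & K i t) /\
  (forall i j k, e i j -> K i k -> (k <= s i j k + D)%N /\ (s i j k <= k)%N).

Definition totally_asynchronous {n : nat} (e : rel 'I_n)
    (K : 'I_n -> set nat) (s : 'I_n -> 'I_n -> nat -> nat) :=
  (forall i, infinite_set (K i)) /\
  (forall i j, e i j -> s i j k @[k --> within (K i) \oo] --> \oo).

(* Main.v *)
Require Import Defs.
From HB Require Import structures.
From mathcomp Require Import all_boot all_order all_algebra.
From mathcomp Require Import all_classical all_reals all_analysis.
From mathcomp Require Import mxtens ring lra zify.

(** Write [u_i^k = x_i^k - xi_i] for the error of node [i] relative to an
optimal solution [xi].  A point is optimal exactly when, for every node, minus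
[alpha^-1] times its Laplacian block is a subgradient of [f i + h i]
([optimal_subdiff], [subdiff_optimal]).  An update is a proximal step, so it
satisfies a variational inequality from which the model can be eliminated
([async_iterates_variational]).  Testing that inequality at [xi] and adding the
subgradient inequality of [xi] gives, for an update of node [i] that reads the
delayed errors [v_j] ([async_error_recursion]),

[(1 + gamma theta) |u'|^2 + kappa |u' - u|^2 + sum_j b_j |v_j - u'|^2
   <= (1 - sum_j b_j) |u|^2 + sum_j b_j |v_j|^2],

where [b_j = gamma w_ij / alpha], [theta] is the modulus of strong convexity
(or 0), and the step-size condition says that
[kappa = 1 - gamma (beta + (1 - w_ii) / alpha)] is positive.  The right-hand
side is a convex combination: in the maximum norm over the nodes an update
never increases the error, whatever the delays, and with [theta > 0] it
contracts it by the factor [rho].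

In the strongly convex case only this contraction matters.  Once all values in
use obey a bound [c], every node obeys [rho * c] after its next update; this
yields the rate under partial asynchrony ([partially_async_rate]) and
convergence under total asynchrony ([totally_async_rate]).

Without strong convexity, consider a limit of the shifted iterates
[x^(k + t)] along an ultrafilter over [k].  This limit trajectory is again
a trajectory of the algorithm, with bounded delays
([variational_steps_limit]), and along it the largest error over a window has a
constant value [V].  A node that attains [V] must make the inequality above
tight: it does not move and its error vector equals the delayed ones of its
neighbours ([async_extremal_update]).  By connectivity the limit trajectory is
stationary with the same error vector at all nodes
([extremal_value_spreads]), so its Laplacian blocks are consistent and it is
optimal ([limit_trajectory_critical]).  Taking this limit for [xi], the errors
over one window become arbitrarily small, and they can never grow again, which
is convergence of the whole sequence ([partially_async_converges]). *)

Set Implicit Arguments.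
Unset Strict Implicit.
Unset Printing Implicit Defensive.

Import Order.TTheory GRing.Theory Num.Theory.
Import numFieldNormedType.Exports.

Local Open Scope classical_set_scope.
Local Open Scope ring_scope.

(** * The Euclidean inner product and first-order optimality *)

Lemma dotE (R : realType) (d : nat) (u v : 'rV[R]_d) :
  dot u v = \sum_l u 0 l * v 0 l.
Proof. by rewrite /dot mxE; apply: eq_bigr => l _; rewrite mxE. Qed.

Lemma dotC (R : realType) (d : nat) (u v : 'rV[R]_d) : dot u v = dot v u.
Proof. by rewrite !dotE; apply: eq_bigr => l _; rewrite mulrC. Qed.

Lemma dotDl (R : realType) (d : nat) (u v w : 'rV[R]_d) :
  dot (u + v) w = dot u w + dot v w.
Proof. by rewrite /dot mulmxDl mxE. Qed.

Lemma dotZl (R : realType) (d : nat) (a : R) (u w : 'rV[R]_d) :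
  dot (a *: u) w = a * dot u w.
Proof. by rewrite /dot -scalemxAl mxE. Qed.

Lemma dotNl (R : realType) (d : nat) (u w : 'rV[R]_d) :
  dot (- u) w = - dot u w.
Proof. by rewrite -scaleN1r dotZl mulN1r. Qed.

Lemma dotDr (R : realType) (d : nat) (u v w : 'rV[R]_d) :
  dot w (u + v) = dot w u + dot w v.
Proof. by rewrite !(dotC w) dotDl. Qed.

Lemma dotZr (R : realType) (d : nat) (a : R) (u w : 'rV[R]_d) :
  dot w (a *: u) = a * dot w u.
Proof. by rewrite !(dotC w) dotZl. Qed.

Lemma dotNr (R : realType) (d : nat) (u w : 'rV[R]_d) :
  dot w (- u) = - dot w u.
Proof. by rewrite !(dotC w) dotNl. Qed.

Lemma dot0l (R : realType) (d : nat) (w : 'rV[R]_d) : dot 0 w = 0.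
Proof. by rewrite /dot mul0mx mxE. Qed.

Lemma dot0r (R : realType) (d : nat) (w : 'rV[R]_d) : dot w 0 = 0.
Proof. by rewrite dotC dot0l. Qed.

Lemma dot_suml (R : realType) (d : nat) (I : finType) (P : pred I)
    (F : I -> 'rV[R]_d) (w : 'rV[R]_d) :
  dot (\sum_(i | P i) F i) w = \sum_(i | P i) dot (F i) w.
Proof. by rewrite /dot mulmx_suml summxE. Qed.

Definition dot_lin := (dotDl, dotDr, dotNl, dotNr, dotZl, dotZr).

Lemma dot_ge0 (R : realType) (d : nat) (u : 'rV[R]_d) : 0 <= dot u u.
Proof. by rewrite dotE sumr_ge0 // => l _; rewrite -expr2 sqr_ge0. Qed.

Lemma enorm_sq (R : realType) (d : nat) (u : 'rV[R]_d) :
  enorm u ^+ 2 = dot u u.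
Proof. by rewrite /enorm sqr_sqrtr // dot_ge0. Qed.

Lemma dot_eq0 (R : realType) (d : nat) (u : 'rV[R]_d) : dot u u = 0 -> u = 0.
Proof.
move=> u0; apply/rowP => l; rewrite mxE; apply/eqP; rewrite -sqrf_eq0 expr2.
move: u0; rewrite dotE => /psumr_eq0P -> // l' _; by rewrite -expr2 sqr_ge0.
Qed.

Lemma le0_of_small_multiples (R : realType) (A Q : R) :
  (forall t, 0 < t <= 1 -> A <= t * Q) -> A <= 0.
Proof.
move=> H; case: (leP A 0) => // A0.
have AQ : A <= Q by rewrite -[Q]mul1r; apply: H; rewrite ltr01 lexx.
have Q0 : 0 < Q by lra.
(* At this step the bound is half of A itself. *)
have /H : 0 < A / (2 * Q) <= 1.
  by rewrite divr_gt0 ?mulr_gt0 //= ler_pdivrMr ?mulr_gt0 //; lra.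
have -> : A / (2 * Q) * Q = A / 2 by field; rewrite ?gt_eqF.
lra.
Qed.

(** Along the segment from [z] to [y] the error term is quadratic in the step
while both sides of the convexity inequality are affine in it, so dividing by
the step and letting it vanish removes the error. *)
Lemma subdiff_of_quadratic_error (R : realType) (d : nat)
    (psi : 'rV[R]_d -> \bar R) (z g : 'rV[R]_d) (a : R) :
  cvx_fun psi -> (forall y, psi y != -oo%E) -> psi z \is a fin_num ->
  (forall y, (psi z + (dot g (y - z))%:E
              <= psi y + (a * dot (y - z) (y - z))%:E)%E) ->
  subdiff psi z g.
Proof.
move=> cvx noo fz H y; move: (noo y).
case Ey : (psi y) => [r| |] // _; last by rewrite leey.
rewrite -(fineK fz); set p := fine (psi z).
rewrite -EFinD lee_fin -subr_le0.
apply: (@le0_of_small_multiples _ _ (a * dot (y - z) (y - z))) => t /andP[t0 t1].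
have := cvx y z t; rewrite (ltW t0) t1 => /(_ isT).
have := H (t *: y + (1 - t) *: z).
have -> : t *: y + (1 - t) *: z - z = t *: (y - z).
  by rewrite scalerBl scale1r scalerBr -addrA addrAC subrr add0r.
rewrite Ey -(fineK fz) -/p -EFinD -!EFinM -EFinD.
move=> h1 h2; have := le_trans h1 (leeD2r _ h2).
rewrite -EFinD lee_fin !dot_lin => h.
rewrite -(ler_pM2l t0); move: h; lra.
Qed.

Lemma cvx_funD (R : realType) (d : nat) (f : 'rV[R]_d -> R)
    (h : 'rV[R]_d -> \bar R) :
  cvx_fun (fun z => (f z)%:E) -> cvx_fun h -> (forall z, h z != -oo%E) ->
  cvx_fun (fun z => ((f z)%:E + h z)%E).
Proof.
move=> cf ch hn x y t t01; have /andP[t0 t1] := t01.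
have [->|tn0] := eqVneq t 0.
  by rewrite !(subr0, scale0r, scale1r, mul0e, mul1e, add0r, add0e).
have [->|tn1] := eqVneq t 1.
  by rewrite !(subrr, scale0r, scale1r, mul0e, mul1e, addr0, adde0).
have {}t0 : 0 < t by rewrite lt_neqAle eq_sym tn0.
have {}t1 : 0 < 1 - t by rewrite subr_gt0 lt_neqAle tn1.
apply: (le_trans (leeD (cf x y t t01) (ch x y t t01))).
move: (hn x) (hn y); case: (h x) (h y) => [r| |] [q| |] // _ _;
  rewrite ?addey // ?gt0_muley ?lte_fin // ?addye ?addey ?leey //.
by rewrite -?EFinM -?EFinD -?EFinM -?EFinD lee_fin; lra.
Qed.

(** * The Laplacian form and the optimality conditions *)

(** When the rows of [W] sum to 1 this is the [i]-th block of
[(I - W (x) I_d) x], hence half the gradient of the Laplacian form when [W] is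
also symmetric. *)
Definition laplacian_row (R : realType) (n d : nat) (W : 'M[R]_n)
    (x : 'M[R]_(n, d)) (i : 'I_n) : 'rV[R]_d :=
  \sum_j W i j *: (row i x - row j x).

Lemma sum_mxtens (R : realType) (n d : nat) (F : 'I_n -> 'I_d -> R) :
  \sum_(p < n * d) F (mxtens_unindex p).1 (mxtens_unindex p).2
  = \sum_i \sum_l F i l.
Proof.
rewrite pair_bigA (reindex (@mxtens_index n d)).
  by apply: eq_bigr => il _; rewrite mxtens_indexK.
by exists (@mxtens_unindex n d) => p _; rewrite ?mxtens_indexK ?mxtens_unindexK.
Qed.

Lemma laplacian_formE (R : realType) (n d : nat) (W : 'M[R]_n)
    (x : 'M[R]_(n, d)) :
  (forall i, \sum_j W i j = 1) ->
  laplacian_form W x = \sum_i dot (laplacian_row W x i) (row i x).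
Proof.
move=> W1; rewrite /laplacian_form -mulmxA mulmxBl mul1mx mxE.
transitivity (\sum_i \sum_l x i l * (x i l - \sum_j W i j * x j l)).
  rewrite -sum_mxtens; apply: eq_bigr => p _; rewrite !mxE; congr (_ * (_ - _)).
  set i := (mxtens_unindex p).1; set l := (mxtens_unindex p).2.
  transitivity (\sum_j \sum_k W i j * (l == k)%:R * x j k).
    by rewrite -sum_mxtens; apply: eq_bigr => q _; rewrite !mxE.
  apply: eq_bigr => j _; rewrite (bigD1 l) //= eqxx mulr1 big1 ?addr0 // => k.
  by rewrite eq_sym => /negbTE ->; rewrite mulr0 mul0r.
apply: eq_bigr => i _; rewrite dotE; apply: eq_bigr => l _.
rewrite mulrC; congr (_ * _); last by rewrite mxE.
rewrite /laplacian_row summxE -[x i l in LHS]mul1r -(W1 i) mulr_suml -sumrB.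
by apply: eq_bigr => j _; rewrite !mxE mulrBr.
Qed.

(** Symmetry of the weights turns each edge term into half of two terms, one
for each end point. *)
Lemma laplacian_row_pairing (R : realType) (n d : nat) (W : 'M[R]_n)
    (x y : 'M[R]_(n, d)) :
  W^T = W ->
  \sum_i dot (laplacian_row W x i) (row i y) =
  \sum_i \sum_j W i j / 2 * dot (row i x - row j x) (row i y - row j y).
Proof.
move=> Wsym.
have E i : dot (laplacian_row W x i) (row i y)
    = \sum_j W i j * dot (row i x - row j x) (row i y).
  by rewrite /laplacian_row dot_suml; apply: eq_bigr => j _; rewrite dotZl.
rewrite (eq_bigr _ (fun i _ => E i)).
set S := LHS; have S2 : S = \sum_i \sum_j W i j *
    - dot (row i x - row j x) (row j y).
  rewrite /S exchange_big; apply: eq_bigr => i _; apply: eq_bigr => j _ /=.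
  by rewrite -{1}Wsym mxE -dotNl opprB.
have -> : S = (S + S) / 2 by field.
rewrite {2}S2 /S -big_split mulr_suml; apply: eq_bigr => i _ /=.
rewrite -big_split mulr_suml; apply: eq_bigr => j _ /=.
by rewrite !dot_lin; field.
Qed.

Lemma laplacian_form_ge0 (R : realType) (n d : nat) (W : 'M[R]_n)
    (x : 'M[R]_(n, d)) :
  W^T = W -> doubly_stochastic W -> 0 <= laplacian_form W x.
Proof.
move=> Wsym [W0 W1 _]; rewrite laplacian_formE // laplacian_row_pairing //.
apply: sumr_ge0 => i _; apply: sumr_ge0 => j _.
by rewrite mulr_ge0 ?dot_ge0 // divr_ge0.
Qed.

Lemma laplacian_form_expand (R : realType) (n d : nat) (W : 'M[R]_n)
    (x y : 'M[R]_(n, d)) :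
  W^T = W -> doubly_stochastic W ->
  laplacian_form W y = laplacian_form W x
    + 2 * \sum_i dot (laplacian_row W x i) (row i y - row i x)
    + laplacian_form W (y - x).
Proof.
move=> Wsym [_ W1 _]; rewrite !laplacian_formE //.
under [X in 2 * X]eq_bigr do rewrite -raddfB.
rewrite !laplacian_row_pairing // mulr_sumr -!big_split; apply: eq_bigr => i _.
rewrite /= mulr_sumr -!big_split; apply: eq_bigr => j _ /=.
by rewrite !raddfB /= !dot_lin ![dot (row _ y) (row _ x)]dotC; field.
Qed.

Lemma sum_neighbours (R : realType) (n : nat) (V : lmodType R) (e : rel 'I_n)
    (W : 'M[R]_n) (i : 'I_n) (F : 'I_n -> V) :
  averaging_matrix e W -> F i = 0 ->
  \sum_j W i j *: F j = \sum_(j | e i j) W i j *: F j.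
Proof.
move=> [_ _ _ W0] Fi; rewrite [RHS]big_mkcond; apply: eq_bigr => j _.
case: ifPn => // nij; have [->|ji] := eqVneq j i; first by rewrite Fi scaler0.
by rewrite W0 ?scale0r // negb_or nij.
Qed.

Lemma sum_neighbour_weights (R : realType) (n : nat) (e : rel 'I_n)
    (W : 'M[R]_n) (i : 'I_n) :
  averaging_matrix e W -> ~~ e i i -> \sum_(j | e i j) W i j = 1 - W i i.
Proof.
move=> avg eii; have [_ [_ W1 _] _ W0] := avg.
rewrite -(W1 i) [in RHS](bigD1 i) //= [RHS]addrAC subrr add0r.
rewrite [RHS](bigID (e i)) /= [X in _ + X]big1 ?addr0; last first.
  by move=> j /andP[ji nij]; rewrite W0 // negb_or nij.
apply: eq_bigl => j; case: eqVneq => [->|//]; exact: negbTE.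
Qed.

Lemma objective_fin (R : realType) (n d : nat) (f : 'I_n -> 'rV[R]_d -> R)
    (h : 'I_n -> 'rV[R]_d -> \bar R) (W : 'M[R]_n) (alpha : R)
    (x : 'M[R]_(n, d)) :
  (forall i, h i (row i x) \is a fin_num) ->
  objective f h W alpha x =
  (\sum_i (f i (row i x) + fine (h i (row i x)))
   + (2 * alpha)^-1 * laplacian_form W x)%:E.
Proof.
move=> fin; rewrite /objective big_split /= !EFinD -!sumEFin; congr (_ + _ + _)%E.
by apply: eq_bigr => i _; rewrite fineK.
Qed.

Lemma objective_infty (R : realType) (n d : nat) (f : 'I_n -> 'rV[R]_d -> R)
    (h : 'I_n -> 'rV[R]_d -> \bar R) (W : 'M[R]_n) (alpha : R)
    (x : 'M[R]_(n, d)) (i : 'I_n) :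
  (forall i z, h i z != -oo%E) -> h i (row i x) = +oo%E ->
  objective f h W alpha x = +oo%E.
Proof.
move=> hn hi; rewrite /objective (bigD1 i) //= [X in (_ + X + _)%E](bigD1 i) //=.
rewrite hi sumEFin -EFinD addye; first by rewrite addey.
by apply/eqP => /esum_eqNyP[j [_ _ /eqP]]; apply/negP; rewrite hn.
Qed.

Lemma optimal_fin (R : realType) (n d : nat) (f : 'I_n -> 'rV[R]_d -> R)
    (h : 'I_n -> 'rV[R]_d -> \bar R) (W : 'M[R]_n) (alpha : R)
    (x : 'M[R]_(n, d)) :
  (forall i, proper_fun (h i)) -> optimal f h W alpha x ->
  forall i, h i (row i x) \is a fin_num.
Proof.
move=> ph opt i; rewrite fin_numE (proj1 (ph i)); apply/eqP => hi.
have /choice[y yP] j : exists y, h j y != +oo%E := proj2 (ph j).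
have := opt (\matrix_j y j).
rewrite (objective_infty f W alpha (fun j => proj1 (ph j)) hi) objective_fin //.
by move=> j; rewrite rowK fin_numE yP (proj1 (ph j)).
Qed.

(** Moving a single block keeps the other terms of the objective, and the
Laplacian form changes by an affine term and a quadratic error. *)
Lemma optimal_subdiff (R : realType) (n d : nat) (f : 'I_n -> 'rV[R]_d -> R)
    (h : 'I_n -> 'rV[R]_d -> \bar R) (W : 'M[R]_n) (alpha : R)
    (x : 'M[R]_(n, d)) :
  W^T = W -> doubly_stochastic W -> 0 < alpha ->
  (forall i, cvx_fun (fun z => (f i z)%:E)) ->
  (forall i, proper_fun (h i)) -> (forall i, cvx_fun (h i)) ->
  optimal f h W alpha x ->
  forall i, subdiff (fun z => ((f i z)%:E + h i z)%E) (row i x)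
    (- (alpha^-1 *: laplacian_row W x i)).
Proof.
move=> Wsym Wds a0 cf ph ch opt i; have fin := optimal_fin ph opt.
apply: (@subdiff_of_quadratic_error _ _ _ _ _
  ((2 * alpha)^-1 * (1 - W i i))).
- by apply: cvx_funD => // z; exact: proj1 (ph i) z.
- by move=> y; rewrite adde_eq_ninfty /= (proj1 (ph i)).
- by rewrite fin_numD /= fin.
move=> y; have /orP[/eqP->|fy] : (h i y == +oo%E) || (h i y \is a fin_num).
  by rewrite fin_numE (proj1 (ph i)) /=; case: eqP.
  by rewrite addey // addye ?leey.
pose x' := \matrix_j (if j == i then y else row j x).
have rx' j : row j x' = if j == i then y else row j x by rewrite rowK.
have fin' j : h j (row j x') \is a fin_num.
  by rewrite rx'; case: eqVneq => [->|].
have := opt x'; rewrite !objective_fin // lee_fin.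
rewrite (laplacian_form_expand x x' Wsym Wds).
rewrite (bigD1 i) //= [X in _ <= X + _ -> _](bigD1 i) //=.
rewrite [X in _ <= _ + X + _ -> _](eq_bigr
  (fun j => f j (row j x) + fine (h j (row j x)))); last first.
  by move=> j /negbTE ji; rewrite rx' ji.
have -> : \sum_j dot (laplacian_row W x j) (row j x' - row j x)
    = dot (laplacian_row W x i) (y - row i x).
  rewrite (bigD1 i) //= big1 ?addr0; first by rewrite rx' eqxx.
  by move=> j /negbTE ji; rewrite rx' ji subrr dot0r.
have Wi : \sum_(j | j != i) W i j = 1 - W i i.
  by have [_ W1 _] := Wds; rewrite -(W1 i) [in RHS](bigD1 i) //= [RHS]addrAC subrr add0r.
have -> : laplacian_form W (x' - x) = (1 - W i i) * dot (y - row i x) (y - row i x).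
  have [_ W1 _] := Wds; rewrite laplacian_formE // (bigD1 i) //= big1 ?addr0.
    rewrite /laplacian_row dot_suml (bigD1 i) //= subrr scaler0 dot0l add0r.
    rewrite -Wi mulr_suml; apply: eq_bigr => j /negbTE ji.
    by rewrite !raddfB /= !rx' eqxx ji subrr addr0 -scalerBr dotZl.
  by move=> j /negbTE ji; rewrite raddfB /= rx' ji subrr dot0r.
rewrite rx' eqxx -(fineK (fin i)) -(fineK fy) -!EFinD lee_fin !fineK //.
rewrite dotNl dotZl => H.
have E : (2 * alpha)^-1 * (2 * dot (laplacian_row W x i) (y - row i x)) =
  alpha^-1 * dot (laplacian_row W x i) (y - row i x) by field; rewrite gt_eqF.
move: H; rewrite !mulrDr E; lra.
Qed.

(** The Laplacian form is positive semidefinite, so the linear minorants that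
the blocks provide add up to a minorant of the objective that is tight at
[x]. *)
Lemma subdiff_optimal (R : realType) (n d : nat) (f : 'I_n -> 'rV[R]_d -> R)
    (h : 'I_n -> 'rV[R]_d -> \bar R) (W : 'M[R]_n) (alpha : R)
    (x : 'M[R]_(n, d)) :
  W^T = W -> doubly_stochastic W -> 0 < alpha ->
  (forall i, proper_fun (h i)) ->
  (forall i, subdiff (fun z => ((f i z)%:E + h i z)%E) (row i x)
    (- (alpha^-1 *: laplacian_row W x i))) ->
  optimal f h W alpha x.
Proof.
move=> Wsym Wds a0 ph sd y.
have fin i : h i (row i x) \is a fin_num.
  have [z zP] := proj2 (ph i); rewrite fin_numE (proj1 (ph i)); apply/eqP => hi.
  have fz : h i z \is a fin_num by rewrite fin_numE zP (proj1 (ph i)).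
  by have := sd i z; rewrite hi -(fineK fz) -EFinD addey // addye // leye_eq.
have [finy|] := pselect (forall i, h i (row i y) \is a fin_num); last first.
  move=> /existsNP[i /negP]; rewrite fin_numE (proj1 (ph i)) /= negbK => /eqP hi.
  by rewrite (objective_infty f W alpha (fun j => proj1 (ph j)) hi) leey.
rewrite !objective_fin // lee_fin (laplacian_form_expand x y Wsym Wds).
have q0 := laplacian_form_ge0 (y - x) Wsym Wds.
have {}q0 : 0 <= (2 * alpha)^-1 * laplacian_form W (y - x).
  by rewrite mulr_ge0 // invr_ge0 mulr_ge0 // ltW.
have : \sum_i (f i (row i x) + fine (h i (row i x)))
    - alpha^-1 * \sum_i dot (laplacian_row W x i) (row i y - row i x)
    <= \sum_i (f i (row i y) + fine (h i (row i y))).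
  rewrite mulr_sumr -sumrB; apply: ler_sum => i _.
  have := sd i (row i y); rewrite -(fineK (fin i)) -(fineK (finy i)) -!EFinD.
  by rewrite lee_fin dotNl dotZl.
set A := \sum_i _; set B := \sum_i dot _ _; set C := \sum_i (f i _ + _).
have E : (2 * alpha)^-1 * (2 * B) = alpha^-1 * B by field; rewrite gt_eqF.
rewrite !mulrDr E; lra.
Qed.

(** * One asynchronous proximal step *)

(** Expanding the proximal term around the minimizer leaves a linear term and
the quadratic error that [subdiff_of_quadratic_error] removes. *)
Lemma prox_step_subdiff (R : realType) (d : nat) (m : 'rV[R]_d -> R)
    (h : 'rV[R]_d -> \bar R) (gamma a : R) (G x z : 'rV[R]_d) :
  0 < gamma -> cvx_fun (fun y => (m y)%:E) -> proper_fun h -> cvx_fun h ->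
  argmin (fun y => ((m y)%:E + h y + (enorm (y - x) ^+ 2 / (2 * gamma))%:E
                    + (a * dot G y)%:E)%E) z ->
  subdiff (fun y => ((m y)%:E + h y)%E) z
    (- (gamma^-1 *: (z - x) + a *: G)).
Proof.
move=> g0 cm [hn [y0 hy0]] ch zmin.
have fz : h z \is a fin_num.
  rewrite fin_numE hn; apply/eqP => hz.
  have fy0 : h y0 \is a fin_num by rewrite fin_numE hn.
  by have := zmin y0; rewrite hz -(fineK fy0) -!EFinD addey // !addye // leye_eq.
apply: (@subdiff_of_quadratic_error _ _ _ _ _ (2 * gamma)^-1).
- exact: cvx_funD.
- by move=> y; rewrite adde_eq_ninfty /= hn.
- by rewrite fin_numD /= fz.
move=> y; have /orP[/eqP->|fy] : (h y == +oo%E) || (h y \is a fin_num).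
  by rewrite fin_numE hn /=; case: eqP.
  by rewrite addey // addye ?leey.
have := zmin y; rewrite /= -(fineK fz) -(fineK fy) -!EFinD !lee_fin !enorm_sq.
set c := (2 * gamma)^-1; have -> : gamma^-1 = 2 * c.
  by rewrite /c; field; rewrite gt_eqF.
rewrite !dot_lin (dotC x y) (dotC x z) (dotC y z); lra.
Qed.

Definition delayed_laplacian_row (R : realType) (n d : nat) (e : rel 'I_n)
    (W : 'M[R]_n) (s : 'I_n -> 'I_n -> nat -> nat) (x : nat -> 'M[R]_(n, d))
    (i : 'I_n) (k : nat) : 'rV[R]_d :=
  \sum_(j | e i j) W i j *: (row i (x k) - row j (x (s i j k))).

(** The variational inequality of the proximal subproblem with the model
eliminated: the two bounds on the model replace it by [f i], at the price of a
term that is quadratic in the displacement. *)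
Definition variational_steps (R : realType) (n d : nat) (e : rel 'I_n)
    (f : 'I_n -> 'rV[R]_d -> R) (h : 'I_n -> 'rV[R]_d -> \bar R)
    (W : 'M[R]_n) (alpha : R) (gamma beta : 'I_n -> R) (K : 'I_n -> set nat)
    (s : 'I_n -> 'I_n -> nat -> nat) (x : nat -> 'M[R]_(n, d)) :=
  forall i k, K i k -> forall y,
    ((f i (row i (x k.+1)) - beta i / 2 *
       dot (row i (x k.+1) - row i (x k)) (row i (x k.+1) - row i (x k)))%:E
      + h i (row i (x k.+1))
      + (dot (- ((gamma i)^-1 *: (row i (x k.+1) - row i (x k))
                 + alpha^-1 *: delayed_laplacian_row e W s x i k))
             (y - row i (x k.+1)))%:E
     <= (f i y)%:E + h i y)%E.

Lemma async_iterates_variational (R : realType) (n d : nat) (e : rel 'I_n)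
    (f : 'I_n -> 'rV[R]_d -> R) (h : 'I_n -> 'rV[R]_d -> \bar R)
    (W : 'M[R]_n) (alpha : R) (m : 'I_n -> nat -> 'rV[R]_d -> R)
    (gammak : 'I_n -> nat -> R) (gamma beta : 'I_n -> R) (K : 'I_n -> set nat)
    (s : 'I_n -> 'I_n -> nat -> nat) (x : nat -> 'M[R]_(n, d)) :
  (forall i k, K i k -> cvx_fun (fun z => (m i k z)%:E)) ->
  (forall i, proper_fun (h i)) -> (forall i, cvx_fun (h i)) ->
  (forall i k z, K i k ->
     m i k z <= f i z <= m i k z + beta i / 2 * enorm (z - row i (x k)) ^+ 2) ->
  (forall i k, gammak i k = gamma i) -> (forall i, 0 < gamma i) ->
  async_iterates e h W alpha m gammak K s x ->
  variational_steps e f h W alpha gamma beta K s x.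
Proof.
move=> cm ph ch model gE g0 it i k Kik y; set z := row i (x k.+1).
set delta := z - _; set G := delayed_laplacian_row e W s x i k.
have [zmin _] := it i k; have {}zmin := zmin Kik.
have := @prox_step_subdiff _ _ (m i k) (h i) (gamma i) alpha^-1 G _ _ (g0 i)
  (cm i k Kik) (ph i) (ch i).
move=> /(_ (row i (x k)) z); rewrite -{1}(gE i k) => /(_ zmin) /(_ y) H.
have /andP[_ fz] := model i k z Kik; have /andP[fy _] := model i k y Kik.
apply: (@le_trans _ _ ((m i k y)%:E + h i y)%E); last first.
  by apply: leeD2r; rewrite lee_fin.
apply: le_trans H; rewrite /=; apply: leeD2r; apply: leeD2r; rewrite lee_fin.
by move: fz; rewrite enorm_sq -/delta; lra.
Qed.

Lemma dot_cross_term (R : realType) (d : nat) (u v w : 'rV[R]_d) :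
  2 * dot (u - v) w
  = dot u u - dot v v - dot (w - u) (w - u) + dot (v - w) (v - w).
Proof. by rewrite !dot_lin (dotC w u) (dotC w v); ring. Qed.

(** Adding the inequality of an update tested at [xi] to the (strong)
subgradient inequality at [xi] cancels the function values.  What remains is
quadratic in the errors, and each cross term [- <u - v_j, u'>] equals
[(|v_j|^2 - |u|^2 + |u' - u|^2 - |v_j - u'|^2) / 2]. *)
Lemma error_recursion (R : realType) (d : nat) (I : finType) (P : pred I)
    (b : I -> R) (gamma c beta theta Fz Fxi : R) (xi x z : 'rV[R]_d)
    (nu y : I -> 'rV[R]_d) :
  0 < gamma ->
  Fz - beta / 2 * dot (z - x) (z - x)
    + dot (- (gamma^-1 *: (z - x)
              + c *: \sum_(j | P j) b j *: (x - y j))) (xi - z) <= Fxi ->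
  Fxi + dot (- (c *: \sum_(j | P j) b j *: (xi - nu j))) (z - xi)
    + theta / 2 * dot (z - xi) (z - xi) <= Fz ->
  (1 + gamma * theta) * dot (z - xi) (z - xi)
    + (1 - gamma * (beta + c * \sum_(j | P j) b j)) * dot (z - x) (z - x)
    + gamma * c * \sum_(j | P j) b j *
        dot ((y j - nu j) - (z - xi)) ((y j - nu j) - (z - xi))
  <= (1 - gamma * (c * \sum_(j | P j) b j)) * dot (x - xi) (x - xi)
    + gamma * c * \sum_(j | P j) b j * dot (y j - nu j) (y j - nu j).
Proof.
move=> g0 H1 H2.
set u' := z - xi; set u := x - xi; set D := z - x; pose v j := y j - nu j.
set S := \sum_(j | P j) b j; set SV := \sum_(j | P j) b j * dot (v j - u') (v j - u').
set Sv := \sum_(j | P j) b j * dot (v j) (v j).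
have ED : D = u' - u by rewrite /D /u' /u opprB addrA subrK.
have Exz : xi - z = - u' by rewrite /u' opprB.
pose A := \sum_(j | P j) b j * dot (x - y j) u'.
pose B := \sum_(j | P j) b j * dot (xi - nu j) u'.
have EA : dot (\sum_(j | P j) b j *: (x - y j)) u' = A.
  by rewrite dot_suml; apply: eq_bigr => j _; rewrite dotZl.
have EB : dot (\sum_(j | P j) b j *: (xi - nu j)) u' = B.
  by rewrite dot_suml; apply: eq_bigr => j _; rewrite dotZl.
have EAB : 2 * (A - B) = S * dot u u - Sv - S * dot D D + SV.
  rewrite /A /B /S /Sv /SV -sumrB mulr_sumr !mulr_suml -!sumrB -big_split /=.
  apply: eq_bigr => j _; rewrite -mulrBr -dotNl -dotDl.
  have -> : x - y j - (xi - nu j) = u - v j.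
    by apply/rowP => l; rewrite !mxE; ring.
  by rewrite mulrCA dot_cross_term -ED; ring.
have EDu : 2 * dot D u' = dot u' u' + dot D D - dot u u.
  have := dot_cross_term u' u u'; rewrite -ED subrr dot0l => ->.
  have -> : u - u' = - D by rewrite -(opprB u' u) -ED.
  by rewrite dotNl dotNr opprK; ring.
have E1 : dot (- (gamma^-1 *: D + c *: \sum_(j | P j) b j *: (x - y j)))
    (xi - z) = gamma^-1 * dot D u' + c * A.
  by rewrite Exz dotNl dotNr opprK dotDl !dotZl EA.
have E2 : dot (- (c *: \sum_(j | P j) b j *: (xi - nu j))) u' = - (c * B).
  by rewrite dotNl dotZl EB.
move: H1 H2; rewrite E1 E2 -/u' -/D => H1 H2.
have H : theta / 2 * dot u' u' - beta / 2 * dot D D + gamma^-1 * dot D u'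
    + c * (A - B) <= 0 by lra.
have {}H : (2 * gamma) * (theta / 2 * dot u' u' - beta / 2 * dot D D
    + gamma^-1 * dot D u' + c * (A - B)) <= 0.
  by rewrite pmulr_rle0 // mulr_gt0.
have E : (2 * gamma) * (theta / 2 * dot u' u' - beta / 2 * dot D D
    + gamma^-1 * dot D u' + c * (A - B)) =
  gamma * theta * dot u' u' - gamma * beta * dot D D + 2 * dot D u'
   + gamma * c * (2 * (A - B)) by field; rewrite gt_eqF.
move: H; rewrite E EDu EAB; lra.
Qed.

(** * Recursion of the error *)

(** The optimality condition of node [i] at [xi], where strong convexity with
modulus [theta i] (possibly 0) adds a quadratic term. *)
Definition strongly_critical (R : realType) (n d : nat)
    (f : 'I_n -> 'rV[R]_d -> R) (h : 'I_n -> 'rV[R]_d -> \bar R)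
    (W : 'M[R]_n) (alpha : R) (theta : 'I_n -> R) (xi : 'M[R]_(n, d)) :=
  forall i y,
    ((f i (row i xi))%:E + h i (row i xi)
      + (dot (- (alpha^-1 *: laplacian_row W xi i)) (y - row i xi)
         + theta i / 2 * dot (y - row i xi) (y - row i xi))%:E
     <= (f i y)%:E + h i y)%E.

Lemma strongly_convex_critical (R : realType) (n d : nat)
    (f : 'I_n -> 'rV[R]_d -> R) (h : 'I_n -> 'rV[R]_d -> \bar R)
    (W : 'M[R]_n) (alpha : R) (theta : 'I_n -> R) (xi : 'M[R]_(n, d)) :
  (forall i, strongly_convex (theta i) (fun z => ((f i z)%:E + h i z)%E)) ->
  (forall i, h i (row i xi) \is a fin_num) ->
  (forall i, subdiff (fun z => ((f i z)%:E + h i z)%E) (row i xi)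
     (- (alpha^-1 *: laplacian_row W xi i))) ->
  strongly_critical f h W alpha theta xi.
Proof.
move=> sc fin sd i y; have [_ /(_ _ y _ (sd i))] := sc i.
rewrite enorm_sq -(fineK (fin i)) -!EFinD.
case: (h i y) => [r| |]; last 2 first.
- by move=> _; rewrite addey // leey.
- by rewrite addeNy !addNye leeNy_eq.
by rewrite -?EFinD -?EFinB -?EFinD !lee_fin; lra.
Qed.

Lemma subdiff_critical (R : realType) (n d : nat)
    (f : 'I_n -> 'rV[R]_d -> R) (h : 'I_n -> 'rV[R]_d -> \bar R)
    (W : 'M[R]_n) (alpha : R) (xi : 'M[R]_(n, d)) :
  (forall i, subdiff (fun z => ((f i z)%:E + h i z)%E) (row i xi)
     (- (alpha^-1 *: laplacian_row W xi i))) ->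
  strongly_critical f h W alpha (fun=> 0) xi.
Proof. by move=> sd i y; rewrite mul0r mul0r addr0; exact: sd. Qed.

Definition err (R : realType) (n d : nat) (x : nat -> 'M[R]_(n, d))
    (xi : 'M[R]_(n, d)) (i : 'I_n) (k : nat) : 'rV[R]_d :=
  row i (x k) - row i xi.

(** [gamma_small] is the step-size condition in a form that needs no division
by [beta i + (1 - W i i) / alpha], which vanishes for an isolated node with an
exact model. *)
Record stable_parameters (R : realType) (n : nat) (e : rel 'I_n)
    (W : 'M[R]_n) (alpha : R) (gamma beta : 'I_n -> R) : Prop := {
  weights_averaging : averaging_matrix e W;
  network_irreflexive : irreflexive e;
  alpha_positive : 0 < alpha;
  gamma_positive : forall i, 0 < gamma i;
  beta_nonnegative : forall i, 0 <= beta i;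
  gamma_small : forall i, gamma i * (beta i + (1 - W i i) / alpha) < 1 }.

Lemma async_error_recursion (R : realType) (n d : nat) (e : rel 'I_n)
    (f : 'I_n -> 'rV[R]_d -> R) (h : 'I_n -> 'rV[R]_d -> \bar R)
    (W : 'M[R]_n) (alpha : R) (gamma beta theta : 'I_n -> R)
    (K : 'I_n -> set nat) (s : 'I_n -> 'I_n -> nat -> nat)
    (x : nat -> 'M[R]_(n, d)) (xi : 'M[R]_(n, d)) :
  stable_parameters e W alpha gamma beta ->
  (forall i z, h i z != -oo%E) -> (forall i, h i (row i xi) \is a fin_num) ->
  variational_steps e f h W alpha gamma beta K s x ->
  strongly_critical f h W alpha theta xi ->
  forall i k, K i k ->
  (1 + gamma i * theta i) * dot (err x xi i k.+1) (err x xi i k.+1)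
    + (1 - gamma i * (beta i + (1 - W i i) / alpha)) *
      dot (row i (x k.+1) - row i (x k)) (row i (x k.+1) - row i (x k))
    + gamma i / alpha * \sum_(j | e i j) W i j *
        dot (err x xi j (s i j k) - err x xi i k.+1)
            (err x xi j (s i j k) - err x xi i k.+1)
  <= (1 - gamma i * (1 - W i i) / alpha) * dot (err x xi i k) (err x xi i k)
    + gamma i / alpha * \sum_(j | e i j) W i j *
        dot (err x xi j (s i j k)) (err x xi j (s i j k)).
Proof.
move=> [avg irr _ g0 _ _] hn fin vs sc i k Kik.
have fy : h i (row i (x k.+1)) \is a fin_num.
  rewrite fin_numE hn; apply/eqP => hy; have := vs i k Kik (row i xi).
  by rewrite hy -(fineK (fin i)) -EFinD addey // addye // leye_eq.
have := vs i k Kik (row i xi); have := sc i (row i (x k.+1)).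
rewrite -(fineK (fin i)) -(fineK fy) -!EFinD !lee_fin => H2 H1.
have S1 := sum_neighbour_weights avg (negbT (irr i)).
have H := @error_recursion R d _ (e i) (W i) (gamma i) alpha^-1 (beta i) (theta i)
  (f i (row i (x k.+1)) + fine (h i (row i (x k.+1))))
  (f i (row i xi) + fine (h i (row i xi))) (row i xi) (row i (x k))
  (row i (x k.+1)) (fun j => row j xi) (fun j => row j (x (s i j k))) (g0 i).
rewrite S1 (mulrC alpha^-1) mulrA in H; apply: H; first by move: H1; lra.
move: H2; rewrite /laplacian_row (sum_neighbours avg) ?subrr //; lra.
Qed.

Lemma weighted_errors_le (R : realType) (n : nat) (e : rel 'I_n)
    (W : 'M[R]_n) (alpha : R) (gamma beta : 'I_n -> R) (i : 'I_n) (c u : R)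
    (v : 'I_n -> R) :
  stable_parameters e W alpha gamma beta ->
  u <= c -> (forall j, e i j -> v j <= c) ->
  (1 - gamma i * (1 - W i i) / alpha) * u
    + gamma i / alpha * \sum_(j | e i j) W i j * v j <= c.
Proof.
move=> [avg irr a0 g0 b0 gb] uc vc; have [_ [W0 _ _] _ _] := avg.
have S1 := sum_neighbour_weights avg (negbT (irr i)).
have ga : 0 <= gamma i / alpha by rewrite ltW // divr_gt0.
have P1 : (1 - gamma i * (1 - W i i) / alpha) * u
    <= (1 - gamma i * (1 - W i i) / alpha) * c.
  rewrite ler_wpM2l // subr_ge0 -mulrA (le_trans _ (ltW (gb i))) //.
  by rewrite ler_pM2l // lerDr.
have P2 : gamma i / alpha * \sum_(j | e i j) W i j * v j
    <= gamma i / alpha * ((1 - W i i) * c).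
  rewrite ler_wpM2l // -S1 mulr_suml ler_sum // => j eij.
  by rewrite ler_wpM2l // vc.
have E : gamma i / alpha * ((1 - W i i) * c) = gamma i * (1 - W i i) / alpha * c.
  by field; rewrite gt_eqF.
move: P1 P2; rewrite E; lra.
Qed.

(** The right-hand side of [async_error_recursion] is a convex combination of
squared errors, hence at most the largest of them. *)
Lemma async_error_contraction (R : realType) (n d : nat) (e : rel 'I_n)
    (f : 'I_n -> 'rV[R]_d -> R) (h : 'I_n -> 'rV[R]_d -> \bar R)
    (W : 'M[R]_n) (alpha : R) (gamma beta theta : 'I_n -> R)
    (K : 'I_n -> set nat) (s : 'I_n -> 'I_n -> nat -> nat)
    (x : nat -> 'M[R]_(n, d)) (xi : 'M[R]_(n, d)) :
  stable_parameters e W alpha gamma beta ->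
  (forall i z, h i z != -oo%E) -> (forall i, h i (row i xi) \is a fin_num) ->
  variational_steps e f h W alpha gamma beta K s x ->
  strongly_critical f h W alpha theta xi ->
  forall i k c, K i k -> dot (err x xi i k) (err x xi i k) <= c ->
  (forall j, e i j -> dot (err x xi j (s i j k)) (err x xi j (s i j k)) <= c) ->
  (1 + gamma i * theta i) * dot (err x xi i k.+1) (err x xi i k.+1) <= c.
Proof.
move=> sp hn fin vs sc i k c Kik ci cj.
have := weighted_errors_le sp ci cj.
have := async_error_recursion sp hn fin vs sc Kik.
case: sp => [[_ [W0 _ _] _ _] _ a0 g0 _ gb].
have P1 : 0 <= (1 - gamma i * (beta i + (1 - W i i) / alpha)) *
    dot (row i (x k.+1) - row i (x k)) (row i (x k.+1) - row i (x k)).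
  by rewrite mulr_ge0 ?dot_ge0 // subr_ge0 ltW.
have P2 : 0 <= gamma i / alpha * \sum_(j | e i j) W i j *
    dot (err x xi j (s i j k) - err x xi i k.+1)
        (err x xi j (s i j k) - err x xi i k.+1).
  rewrite mulr_ge0 //; first by rewrite ltW // divr_gt0.
  by rewrite sumr_ge0 // => j _; rewrite mulr_ge0 ?dot_ge0.
lra.
Qed.

(** When an update does not decrease the largest error, the two quadratic terms
on the left of [async_error_recursion] vanish: the node does not move and its
error vector agrees with the delayed error vectors of its neighbours. *)
Lemma async_extremal_update (R : realType) (n d : nat) (e : rel 'I_n)
    (f : 'I_n -> 'rV[R]_d -> R) (h : 'I_n -> 'rV[R]_d -> \bar R)
    (W : 'M[R]_n) (alpha : R) (gamma beta : 'I_n -> R)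
    (K : 'I_n -> set nat) (s : 'I_n -> 'I_n -> nat -> nat)
    (x : nat -> 'M[R]_(n, d)) (xi : 'M[R]_(n, d)) :
  stable_parameters e W alpha gamma beta ->
  (forall i z, h i z != -oo%E) -> (forall i, h i (row i xi) \is a fin_num) ->
  variational_steps e f h W alpha gamma beta K s x ->
  strongly_critical f h W alpha (fun=> 0) xi ->
  forall i k, K i k ->
  let V := dot (err x xi i k.+1) (err x xi i k.+1) in
  dot (err x xi i k) (err x xi i k) <= V ->
  (forall j, e i j -> dot (err x xi j (s i j k)) (err x xi j (s i j k)) <= V) ->
  row i (x k.+1) = row i (x k) /\
  forall j, e i j -> err x xi j (s i j k) = err x xi i k.+1.
Proof.
move=> sp hn fin vs sc i k Kik V ci cj.
have := weighted_errors_le sp ci cj.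
have := async_error_recursion sp hn fin vs sc Kik.
case: sp => [[_ [W0 _ _] Wpos _] _ a0 g0 _ gb].
rewrite mulr0 addr0 mul1r -/V.
set P1 := (1 - gamma i * (beta i + _)) * _; set P2 := gamma i / alpha * _.
have P1_ge0 : 0 <= P1 by rewrite mulr_ge0 ?dot_ge0 // subr_ge0 ltW.
have ga : 0 < gamma i / alpha by rewrite divr_gt0.
have P2_ge0 : 0 <= P2.
  rewrite mulr_ge0 //; first exact: ltW.
  by rewrite sumr_ge0 // => j _; rewrite mulr_ge0 ?dot_ge0.
move=> H1 H2; have P1_0 : P1 = 0 by lra.
have P2_0 : P2 = 0 by lra.
split.
  move/eqP: P1_0; rewrite mulf_eq0 subr_eq0 [1 == _]gt_eqF //= => /eqP.
  by move/dot_eq0/eqP; rewrite subr_eq0 => /eqP.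
move/eqP: P2_0; rewrite mulf_eq0 (gt_eqF ga) /= => /eqP/psumr_eq0P S0 j eij.
have /eqP := S0 (fun j _ => mulr_ge0 (W0 i j) (dot_ge0 _)) j eij.
rewrite mulf_eq0 gt_eqF ?Wpos ?eij //= => /eqP/dot_eq0/eqP.
by rewrite subr_eq0 => /eqP.
Qed.

(** * Asynchronous contractions *)

(** If updates from iteration [T'] on only read values that are not older than
[T], then all they read is covered by the bound on [[T, T']] and by the
values produced since. *)
Lemma async_bound_persists (R : realType) (n : nat) (e : rel 'I_n)
    (K : 'I_n -> set nat) (s : 'I_n -> 'I_n -> nat -> nat)
    (a : 'I_n -> nat -> R) (c : R) (T T' : nat) :
  (T <= T')%N ->
  (forall i k, ~ K i k -> a i k.+1 = a i k) ->
  (forall i k, K i k -> a i k <= c ->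
     (forall j, e i j -> a j (s i j k) <= c) -> a i k.+1 <= c) ->
  (forall i j k, (T' <= k)%N -> K i k -> e i j -> (T <= s i j k <= k)%N) ->
  (forall i k, (T <= k <= T')%N -> a i k <= c) ->
  forall i k, (T <= k)%N -> a i k <= c.
Proof.
move=> TT' hold upd fresh init i k; elim/ltn_ind: k i => k IH i Tk.
have [kT'|T'k] := leqP k T'; first by apply: init; rewrite Tk.
case: k IH Tk T'k => // k IH Tk T'k; rewrite ltnS in T'k.
have Tk' : (T <= k)%N by exact: leq_trans T'k.
have [Kik|/hold ->] := pselect (K i k); last exact: IH.
apply: upd => // [|j eij]; first exact: IH.
have /andP[Ts sk] := fresh i j k T'k Kik eij.
by apply: IH.
Qed.

Lemma hold_after_update (R : realType) (Ki : set nat) (a : nat -> R) (c : R)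
    (t k : nat) :
  (forall k, ~ Ki k -> a k.+1 = a k) ->
  (forall k, (t <= k)%N -> Ki k -> a k.+1 <= c) ->
  Ki t -> (t < k)%N -> a k <= c.
Proof.
move=> hold upd Kt; elim: k => // k IH; rewrite ltnS leq_eqVlt => /orP[/eqP<-|tk].
  exact: upd.
have [Kk|/hold ->] := pselect (Ki k); last exact: IH.
by apply: upd => //; exact: ltnW.
Qed.

(** Once every delayed value obeys a bound [c], a node obeys [rho * c] from its
next update on; partial asynchrony makes this happen for all nodes within
[B + D + 1] iterations. *)
Lemma partially_async_rate (R : realType) (n : nat) (e : rel 'I_n)
    (K : 'I_n -> set nat) (s : 'I_n -> 'I_n -> nat -> nat) (B D : nat)
    (a : 'I_n -> nat -> R) (rho c : R) :
  partially_asynchronous e K s B D -> 0 <= rho ->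
  (forall i k, ~ K i k -> a i k.+1 = a i k) ->
  (forall i k c, K i k -> a i k <= c ->
     (forall j, e i j -> a j (s i j k) <= c) -> a i k.+1 <= rho * c) ->
  (forall i k, a i k <= c) ->
  forall i k, a i k <= rho ^+ (k %/ (B + D + 1)) * c.
Proof.
move=> [upd_often fresh] rho0 hold upd bnd.
suff H q i k : (q * (B + D + 1) <= k)%N -> a i k <= rho ^+ q * c.
  by move=> i k; apply: H; exact: leq_trunc_div.
elim: q i k => [|q IH] i k qk; first by rewrite expr0 mul1r.
have [t /andP[t1 t2] Kt] := upd_often i (q * (B + D + 1) + D)%N.
apply: (@hold_after_update _ (K i) (a i) _ t).
- exact: hold.
- move=> l tl Kil; rewrite exprS -mulrA; apply: upd => // [|j eij].
    by apply: IH; apply: leq_trans tl; apply: leq_trans t1; exact: leq_addr.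
  apply: IH; have [ls _] := fresh i j l eij Kil.
  by rewrite -(leq_add2r D) (leq_trans _ ls) // (leq_trans t1).
- exact: Kt.
- apply: leq_ltn_trans t2 _; apply: leq_trans qk.
  by rewrite mulSn; lia.
Qed.

(** The same induction as under partial asynchrony; the time after which the
next factor [rho] is gained is now finite without a uniform bound. *)
Lemma totally_async_rate (R : realType) (n : nat) (e : rel 'I_n)
    (K : 'I_n -> set nat) (s : 'I_n -> 'I_n -> nat -> nat)
    (a : 'I_n -> nat -> R) (rho c : R) :
  totally_asynchronous e K s ->
  (forall i k, ~ K i k -> a i k.+1 = a i k) ->
  (forall i k c, K i k -> a i k <= c ->
     (forall j, e i j -> a j (s i j k) <= c) -> a i k.+1 <= rho * c) ->
  (forall i k, a i k <= c) ->
  forall q, \forall k \near \oo, forall i, a i k <= rho ^+ q * c.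
Proof.
move=> [upd_often fresh] hold upd bnd; elim=> [|q [T _ IH]].
  by near=> k => i; rewrite expr0 mul1r.
apply: filter_forall => i.
have : \forall k \near \oo, K i k -> forall j, e i j -> (T <= s i j k)%N.
  have : \forall k \near \oo, forall j, K i k -> e i j -> (T <= s i j k)%N.
    apply: filter_forall => j; case: (boolP (e i j)) => [eij|_]; last first.
      by near=> k.
    have : \forall k \near \oo, K i k -> (T <= s i j k)%N.
      exact: fresh i j eij [set m | (T <= m)%N] (nbhs_infty_ge T).
    by apply: filterS => k H Kk _; exact: H.
  by apply: filterS => k H Kk j; exact: H.
move=> [T1 _ HT1].
have [t [Kt tT]] : exists t, K i t /\ (maxn T T1 <= t)%N.
  apply: contrapT => /forallNP noT; apply: (upd_often i).
  apply: (@sub_finite_set _ _ `I_(maxn T T1)) => [t Kt|]; last exact: finite_II.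
  by rewrite /= ltnNge; apply/negP => tT; exact: (noT t).
exists t.+1 => // k tk; apply: (@hold_after_update _ (K i) (a i) _ t) => //.
  exact: hold.
move=> l tl Kl; have := leq_trans tT tl; rewrite geq_max => /andP[Tl T1l].
rewrite exprS -mulrA; apply: upd => // [|j eij]; first exact: IH.
by apply: IH => /=; exact: (HT1 l T1l Kl).
Unshelve. all: by end_near.
Qed.

(** * Limits of trajectories *)

Lemma cvg_mx_coord (R : realType) (T : Type) (F : set_system T) (n d : nat)
    (u : T -> 'M[R]_(n, d)) (a : 'M[R]_(n, d)) :
  Filter F -> (forall i l, u k i l @[k --> F] --> a i l) ->
  u k @[k --> F] --> a.
Proof.
move=> FF H; apply/cvg_ballP => eps eps0.
have : \forall k \near F, forall i l, ball (a i l) eps (u k i l).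
  apply: filter_forall => i; apply: filter_forall => l.
  by move/cvg_ballP: (H i l) => /(_ eps eps0).
by apply: filterS => k Hk; split.
Qed.

Lemma cvg_coord (R : realType) (T : Type) (F : set_system T) (n d : nat)
    (u : T -> 'M[R]_(n, d)) (a : 'M[R]_(n, d)) i l :
  Filter F -> u k @[k --> F] --> a -> u k i l @[k --> F] --> a i l.
Proof. by move=> FF ua; apply: cvg_comp ua (@coord_continuous _ _ _ i l a). Qed.

Lemma cvg_row (R : realType) (T : Type) (F : set_system T) (n d : nat)
    (u : T -> 'M[R]_(n, d)) (a : 'M[R]_(n, d)) i :
  Filter F -> u k @[k --> F] --> a -> row i (u k) @[k --> F] --> row i a.
Proof.
move=> FF ua; apply: cvg_mx_coord => o l; rewrite mxE.
under eq_fun do rewrite mxE.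
exact: cvg_coord.
Qed.

Lemma cvg_dot (R : realType) (T : Type) (F : set_system T) (d : nat)
    (u v : T -> 'rV[R]_d) (a b : 'rV[R]_d) :
  Filter F -> u k @[k --> F] --> a -> v k @[k --> F] --> b ->
  dot (u k) (v k) @[k --> F] --> dot a b.
Proof.
move=> FF ua vb; rewrite dotE; under eq_fun do rewrite dotE.
apply: cvg_big => [|l _]; first exact: add_continuous.
by apply: cvgM; exact: cvg_coord.
Qed.

Lemma cvg_mx_sqdist (R : realType) (T : Type) (F : set_system T) (n d : nat)
    (u : T -> 'M[R]_(n, d)) (a : 'M[R]_(n, d)) :
  Filter F ->
  (forall eps, 0 < eps -> \forall k \near F, forall i,
     dot (row i (u k) - row i a) (row i (u k) - row i a) <= eps) ->
  u k @[k --> F] --> a.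
Proof.
move=> FF H; apply: cvg_mx_coord => i l; apply/cvgrPdist_le => eps eps0.
have := H _ (exprn_gt0 2 eps0); apply: filterS => k /(_ i).
rewrite dotE (bigD1 l) //= => Hk.
rewrite -(@ler_pXn2r _ 2) ?nnegrE ?(ltW eps0) // -normrX ger0_norm ?sqr_ge0 //.
apply: le_trans Hk; rewrite -[leLHS]addr0 lerD //.
  by rewrite !mxE expr2 -mulrNN !opprB.
by rewrite sumr_ge0 // => l' _; rewrite -expr2 sqr_ge0.
Qed.

(** Segments are compact, and a cluster point of an ultrafilter is a limit. *)
Lemma ultra_cvg_bounded (R : realType) (T : Type) (U : set_system T)
    (u : T -> R) (M : R) :
  UltraFilter U -> (forall k, `|u k| <= M) ->
  exists a : R, u k @[k --> U] --> a.
Proof.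
move=> UU bnd.
have UM : (u k @[k --> U]) `[- M, M]%classic.
  suff : U (u @^-1` `[- M, M]%classic) by [].
  by apply: filterE => k; rewrite /= in_itv /= -ler_norml.
have [a [_ clu]] := segment_compact _ UM.
exists a => A Aa; have [//|nA] := in_ultra_setVsetC (u @^-1` A) UU.
have [y [nAy Ay]] := clu (~` A) A nA Aa; exact: False_ind _ (nAy Ay).
Qed.

Lemma ultra_finite_choice (T : Type) (U : set_system T) (N : nat)
    (A : nat -> set T) :
  UltraFilter U -> U [set k | exists2 r, (r < N)%N & A r k] ->
  exists2 r, (r < N)%N & U (A r).
Proof.
move=> UU; elim: N => [|N IH] UN.
  have [k [r]] := filter_ex UN; by rewrite ltn0.
have [UA|UnA] := in_ultra_setVsetC (A N) UU; first by exists N.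
have [] := IH; last by move=> r rN UA; exists r => //; exact: ltnW.
apply: filterS2 UN UnA => k [r rN Ar] nA; exists r => //.
by move: rN; rewrite ltnS leq_eqVlt => /orP[/eqP rN|//]; rewrite rN in Ar.
Qed.

(** Everything but the value of [h i] at the updated block is continuous, so an
update says that a convergent sequence of points lies in the epigraph of
[h i], which is closed. *)
Lemma variational_steps_limit (R : realType) (n d : nat) (e : rel 'I_n)
    (f : 'I_n -> 'rV[R]_d -> R) (h : 'I_n -> 'rV[R]_d -> \bar R)
    (W : 'M[R]_n) (alpha : R) (gamma beta : 'I_n -> R)
    (K K' : 'I_n -> set nat) (s s' : 'I_n -> 'I_n -> nat -> nat)
    (x z : nat -> 'M[R]_(n, d)) (U : set_system nat) :
  ProperFilter U ->
  (forall i a, {for a, continuous (f i)}) -> (forall i, closed_fun (h i)) ->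
  (forall i a, h i a != -oo%E) ->
  variational_steps e f h W alpha gamma beta K s x ->
  (forall t, x (k + t)%N @[k --> U] --> z t) ->
  (forall i t, K' i t -> \forall k \near U, K i (k + t)%N /\
     forall j, e i j -> s i j (k + t)%N = (k + s' i j t)%N) ->
  variational_steps e f h W alpha gamma beta K' s' z.
Proof.
move=> UU cf clh hn vs xz lim i t K't y.
have /orP[/eqP->|fy] : (h i y == +oo%E) || (h i y \is a fin_num).
  by rewrite fin_numE hn /=; case: eqP.
  by rewrite [leRHS]addey // leey.
have xr j r : row j (x (k + r)%N) @[k --> U] --> row j (z r) by exact: cvg_row.
pose D k r := row i (x (k + r.+1)%N) - row i (x (k + r)%N).
have cD : D k t @[k --> U] --> row i (z t.+1) - row i (z t) by exact: cvgB.
pose G k := \sum_(j | e i j) W i j *: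
  (row i (x (k + t)%N) - row j (x (k + s' i j t)%N)).
have cG : G k @[k --> U] --> delayed_laplacian_row e W s' z i t.
  apply: cvg_big => [|j _]; first exact: add_continuous.
  by apply: cvgZr; exact: cvgB.
(* The bound that the update puts on the value of h i at the updated block. *)
pose Q k := f i y + fine (h i y)
  - dot (- ((gamma i)^-1 *: D k t + alpha^-1 *: G k))
        (y - row i (x (k + t.+1)%N))
  - (f i (row i (x (k + t.+1)%N)) - beta i / 2 * dot (D k t) (D k t)).
pose Qoo := f i y + fine (h i y)
  - dot (- ((gamma i)^-1 *: (row i (z t.+1) - row i (z t))
            + alpha^-1 *: delayed_laplacian_row e W s' z i t))
        (y - row i (z t.+1))
  - (f i (row i (z t.+1)) - beta i / 2 *
       dot (row i (z t.+1) - row i (z t)) (row i (z t.+1) - row i (z t))).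
have cQ : Q k @[k --> U] --> Qoo.
  apply: cvgB; last first.
    apply: cvgB; first by apply: continuous_cvg (cf i _) (xr i t.+1).
    by apply: cvgM; [exact: cvg_cst|exact: cvg_dot].
  apply: cvgB; first exact: cvg_cst.
  apply: cvg_dot; last by apply: cvgB; [exact: cvg_cst|exact: xr].
  by apply: cvgN; apply: cvgD; exact: cvgZr.
have cP : (row i (x (k + t.+1)%N), Q k) @[k --> U] --> (row i (z t.+1), Qoo).
  exact: cvg_pair (xr i t.+1) cQ.
have epi : (h i (row i (z t.+1)) <= Qoo%:E)%E.
  apply: (closed_cvg (fun p : 'rV[R]_d * R => (h i p.1 <= p.2%:E)%E)
    (clh i) _ _ cP).
  apply: filterS (lim i t K't) => k [Kik sE] /=.
  have := vs i _ Kik y; rewrite -addnS.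
  have -> : delayed_laplacian_row e W s x i (k + t) = G k.
    by apply: eq_bigr => j eij; rewrite sE.
  rewrite -/(D k t) -(fineK fy).
  move: (hn i (row i (x (k + t.+1)%N))); rewrite /Q.
  case: (h i (row i (x (k + t.+1)%N))) => [r| |] // _.
  by rewrite -!EFinD !lee_fin; lra.
move: epi; rewrite /Qoo -(fineK fy); move: (hn i (row i (z t.+1))).
case: (h i (row i (z t.+1))) => [r| |] // _.
by rewrite -!EFinD !lee_fin; lra.
Qed.

(** * Extremal errors *)

(** A value with property [Q] can only be reached by standing still, so a node
that has such a value late has had it all along; some node has one at all
times, it forces the same value on its neighbours, and the network is
connected. *)
Lemma extremal_value_spreads (n : nat) (e : rel 'I_n) (T : Type)
    (K : 'I_n -> set nat) (s : 'I_n -> 'I_n -> nat -> nat)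
    (p : 'I_n -> nat -> T) (Q : T -> Prop) (D : nat) :
  connected_network e ->
  (forall i k, exists2 t, (k <= t)%N & K i t) ->
  (forall i j t, e i j -> K i t -> (t <= s i j t + D)%N) ->
  (forall i t, (D <= t)%N -> ~ K i t -> p i t.+1 = p i t) ->
  (forall i t, (D <= t)%N -> K i t -> Q (p i t.+1) ->
     p i t.+1 = p i t /\ forall j, e i j -> p j (s i j t) = p i t.+1) ->
  (forall t, exists i r, (t <= r)%N /\ Q (p i r)) ->
  exists c, forall i t, (D <= t)%N -> p i t = c.
Proof.
move=> conn often fresh hold upd late.
have back i r t : (D <= r <= t)%N -> Q (p i t) -> p i r = p i t.
  elim: t => [|t IH] /andP[Dr rt] Qt.
    by move: rt; rewrite leqn0 => /eqP ->.
  move: rt; rewrite leq_eqVlt => /orP[/eqP -> //|]; rewrite ltnS => rt.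
  have Dt : (D <= t)%N by exact: leq_trans rt.
  have E : p i t.+1 = p i t.
    by have [Kt|nKt] := pselect (K i t); [case: (upd i t Dt Kt Qt)|exact: hold].
  by rewrite E; apply: IH; rewrite ?Dr // -E.
have [i0 Qi0] : exists i0, forall t, (D <= t)%N -> Q (p i0 t).
  apply: contrapT => /forallNP no.
  have /choice[t tP] i : exists t, (D <= t)%N /\ ~ Q (p i t).
    by move/existsNP: (no i) => [t /not_implyP]; exists t.
  have [i [r [tr Qr]]] := late (\max_i t i).
  have [Dt nQ] := tP i; apply: nQ; rewrite (back i (t i) r) //.
  by rewrite Dt (leq_trans _ tr) // leq_bigmax.
have const0 t : (D <= t)%N -> p i0 t = p i0 D.
  by move=> Dt; rewrite (back i0 D t) ?leqnn //; exact: Qi0.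
exists (p i0 D) => i; have /connectP[q qP ->] := conn i0 i.
have Qc := Qi0 D (leqnn D); move: const0 Qc; move: (p i0 D) => c.
elim: q i0 {Qi0} qP => [|j q IH] i0 /= => [_ H _ //|/andP[ij jq] H Qc].
apply: (IH j) => // t Dt.
have [t' tt' Kt'] := often i0 (t + D)%N.
have Dt' : (D <= t')%N by apply: leq_trans tt'; exact: leq_addl.
have p1 : p i0 t'.+1 = c by apply: H; exact: leqW.
have [_ /(_ j ij) pj] : p i0 t'.+1 = p i0 t' /\
    forall j, e i0 j -> p j (s i0 j t') = p i0 t'.+1.
  by apply: upd; rewrite // p1.
have ts : (t <= s i0 j t')%N.
  by rewrite -(leq_add2r D) (leq_trans tt') // fresh.
by rewrite (back j t (s i0 j t')) ?Dt ?ts // pj p1.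
Qed.

(** [V] is the upper limit of the largest of the [a i k]. *)
Lemma eventual_upper_bound (R : realType) (n : nat) (a : 'I_n.+1 -> nat -> R)
    (c : R) :
  (forall i k, 0 <= a i k) -> (forall i k, a i k <= c) ->
  exists V, (forall eps, 0 < eps -> \forall k \near \oo, forall i, a i k <= V + eps)
    /\ forall v, (\forall k \near \oo, forall i, a i k <= v) -> V <= v.
Proof.
move=> a0 ac; pose E := [set v | \forall k \near \oo, forall i, a i k <= v].
have Elb v : E v -> 0 <= v.
  by move=> [N _ HN]; apply: le_trans (a0 ord0 N) (HN N (leqnn N) ord0).
have infE : has_inf E.
  by split; [exists c; near=> k => i|exists 0 => v /Elb].
exists (inf E); split=> [eps eps0|v Ev].
  have [v Ev vlt] := inf_adherent eps0 infE.
  by apply: filterS Ev => k H i; apply: le_trans (H i) (ltW vlt).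
by apply: ge_inf => //; exact: infE.2.
Unshelve. all: by end_near.
Qed.

Lemma critical_bound_persists (R : realType) (n d : nat) (e : rel 'I_n)
    (f : 'I_n -> 'rV[R]_d -> R) (h : 'I_n -> 'rV[R]_d -> \bar R)
    (W : 'M[R]_n) (alpha : R) (gamma beta : 'I_n -> R)
    (K : 'I_n -> set nat) (s : 'I_n -> 'I_n -> nat -> nat)
    (x : nat -> 'M[R]_(n, d)) (xi : 'M[R]_(n, d)) (c : R) (T T' : nat) :
  stable_parameters e W alpha gamma beta ->
  (forall i z, h i z != -oo%E) -> (forall i, h i (row i xi) \is a fin_num) ->
  variational_steps e f h W alpha gamma beta K s x ->
  (forall i k, ~ K i k -> row i (x k.+1) = row i (x k)) ->
  strongly_critical f h W alpha (fun=> 0) xi ->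
  (T <= T')%N ->
  (forall i j k, (T' <= k)%N -> K i k -> e i j -> (T <= s i j k <= k)%N) ->
  (forall i k, (T <= k <= T')%N -> dot (err x xi i k) (err x xi i k) <= c) ->
  forall i k, (T <= k)%N -> dot (err x xi i k) (err x xi i k) <= c.
Proof.
move=> sp hn fin vs hold sc TT' fresh init.
apply: (async_bound_persists TT' _ _ fresh init) => [i k nK|i k Kik ci cj].
  by rewrite /err hold.
have := async_error_contraction sp hn fin vs sc Kik ci cj.
by rewrite mulr0 addr0 mul1r.
Qed.

Lemma critical_initial_bound (R : realType) (n d : nat) (e : rel 'I_n)
    (f : 'I_n -> 'rV[R]_d -> R) (h : 'I_n -> 'rV[R]_d -> \bar R)
    (W : 'M[R]_n) (alpha : R) (gamma beta : 'I_n -> R)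
    (K : 'I_n -> set nat) (s : 'I_n -> 'I_n -> nat -> nat)
    (x : nat -> 'M[R]_(n, d)) (xi : 'M[R]_(n, d)) :
  stable_parameters e W alpha gamma beta ->
  (forall i z, h i z != -oo%E) -> (forall i, h i (row i xi) \is a fin_num) ->
  variational_steps e f h W alpha gamma beta K s x ->
  (forall i k, ~ K i k -> row i (x k.+1) = row i (x k)) ->
  (forall i j k, K i k -> e i j -> (s i j k <= k)%N) ->
  strongly_critical f h W alpha (fun=> 0) xi ->
  forall i k, dot (err x xi i k) (err x xi i k)
    <= \big[Num.max/0]_j dot (err x xi j 0%N) (err x xi j 0%N).
Proof.
move=> sp hn fin vs hold caus sc i k.
apply: (critical_bound_persists sp hn fin vs hold sc (leqnn 0)) => //.
  by move=> i' j k' _ Kik eij; rewrite leq0n; exact: caus.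
move=> i' k' /andP[_]; rewrite leqn0 => /eqP ->.
exact: (le_bigmax _ (fun j => dot (err x xi j 0%N) (err x xi j 0%N))).
Qed.

(** * Convergence under partial asynchrony *)

Lemma ultralimit_trajectory (R : realType) (n d : nat) (x : nat -> 'M[R]_(n, d))
    (xi : 'M[R]_(n, d)) (c : R) (U : set_system nat) :
  UltraFilter U -> (forall i k, dot (err x xi i k) (err x xi i k) <= c) ->
  exists z : nat -> 'M[R]_(n, d), forall t, x (k + t)%N @[k --> U] --> z t.
Proof.
move=> UU bnd.
have /choice[z zP] (q : nat * ('I_n * 'I_d)) :
    exists a : R, x (k + q.1)%N q.2.1 q.2.2 @[k --> U] --> a.
  case: q => t [i l] /=.
  apply: (@ultra_cvg_bounded _ _ _ _ (`|xi i l| + (1 + c))) => k.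
  rewrite -[x _ i l](addrNK (xi i l)) addrC (le_trans (ler_normD _ _)) //.
  rewrite lerD2l; set w := x _ i l - xi i l.
  have wc : w ^+ 2 <= c.
    apply: le_trans (bnd i (k + t)%N); rewrite dotE (bigD1 l) //= -[leLHS]addr0.
    rewrite lerD //; first by rewrite /w !mxE expr2.
    by rewrite sumr_ge0 // => l' _; rewrite -expr2 sqr_ge0.
  rewrite ler_norml; move: wc; rewrite expr2 => wc.
  by apply/andP; split; nra.
exists (fun t => \matrix_(i, l) z (t, (i, l))) => t.
by apply: cvg_mx_coord => i l; rewrite mxE; exact: (zP (t, (i, l))).
Qed.

(** Delays take at most [D + 1] values, and an ultrafilter decides every finite
alternative; this gives the limit trajectory delays of its own without
extracting subsequences.  Before time [D] a delayed index could precede the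
origin of the shifted trajectory. *)
Lemma ultralimit_delays (n : nat) (e : rel 'I_n) (K : 'I_n -> set nat)
    (s : 'I_n -> 'I_n -> nat -> nat) (B D : nat) (U : set_system nat) :
  UltraFilter U -> partially_asynchronous e K s B D ->
  exists s' : 'I_n -> 'I_n -> nat -> nat,
    forall i j t, (D <= t)%N -> e i j -> (\forall k \near U, K i (k + t)%N) ->
    [/\ (t <= s' i j t + D)%N, (s' i j t <= t)%N &
        \forall k \near U, s i j (k + t)%N = (k + s' i j t)%N].
Proof.
move=> UU [_ fresh].
have /choice[s' s'P] (q : 'I_n * 'I_n * nat) : exists r,
    (D <= q.2)%N -> e q.1.1 q.1.2 -> (\forall k \near U, K q.1.1 (k + q.2)%N) ->
    [/\ (q.2 <= r + D)%N, (r <= q.2)%N &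
        \forall k \near U, s q.1.1 q.1.2 (k + q.2)%N = (k + r)%N].
  case: q => -[i j] t /=.
  have [[Dt eij UK]|no] := pselect
      [/\ (D <= t)%N, e i j & \forall k \near U, K i (k + t)%N]; last first.
    by exists 0%N => ? ? ?; case: no.
  have [|r rt Ur] := @ultra_finite_choice _ U t.+1
      (fun r => [set k | (t <= r + D)%N /\ s i j (k + t)%N = (k + r)%N]) UU.
    apply: filterS UK => k Kk; have [s1 s2] := fresh i j _ eij Kk.
    by exists (s i j (k + t) - k)%N => /=; lia.
  exists r => _ _ _; split.
  - by have [k []] := filter_ex Ur.
  - by rewrite -ltnS.
  - by apply: filterS Ur => k [].
by exists (fun i j t => s' (i, j, t)) => i j t; exact: (s'P (i, j, t)).
Qed.

Lemma ultralimit_updates_often (n : nat) (e : rel 'I_n) (K : 'I_n -> set nat)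
    (s : 'I_n -> 'I_n -> nat -> nat) (B D : nat) (U : set_system nat) :
  UltraFilter U -> partially_asynchronous e K s B D ->
  forall i t, exists2 t', (t <= t')%N & \forall k \near U, K i (k + t')%N.
Proof.
move=> UU [often _] i t.
have [|r _ Ur] := @ultra_finite_choice _ U B.+1
    (fun r => [set k | K i (k + (t + r))%N]) UU.
  apply: filterE => k; have [t' t't Kt'] := often i (k + t)%N.
  exists (t' - (k + t))%N; first by lia.
  by rewrite /= addnA subnKC //; lia.
by exists (t + r)%N => //; exact: leq_addr.
Qed.

Lemma cvg_err (R : realType) (n d : nat) (x : nat -> 'M[R]_(n, d))
    (z : nat -> 'M[R]_(n, d)) (xi : 'M[R]_(n, d)) (U : set_system nat) i t :
  Filter U -> x (k + t)%N @[k --> U] --> z t ->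
  dot (err x xi i (k + t)) (err x xi i (k + t)) @[k --> U]
    --> dot (err z xi i t) (err z xi i t).
Proof.
by move=> FU xz; apply: cvg_dot => //; (apply: cvgB; [exact: cvg_row|exact: cvg_cst]).
Qed.

(** If every node stays below [v] over one window of the limit trajectory, then
so does the original trajectory over infinitely many windows, and from the
first of them on it can never exceed [v] again. *)
Lemma window_bound_eventually (R : realType) (n d : nat) (e : rel 'I_n)
    (f : 'I_n -> 'rV[R]_d -> R) (h : 'I_n -> 'rV[R]_d -> \bar R)
    (W : 'M[R]_n) (alpha : R) (gamma beta : 'I_n -> R)
    (K : 'I_n -> set nat) (s : 'I_n -> 'I_n -> nat -> nat) (B D : nat)
    (x z : nat -> 'M[R]_(n, d)) (xi : 'M[R]_(n, d)) (v : R) (t : nat)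
    (U : set_system nat) :
  stable_parameters e W alpha gamma beta ->
  (forall i z, h i z != -oo%E) -> (forall i, h i (row i xi) \is a fin_num) ->
  variational_steps e f h W alpha gamma beta K s x ->
  (forall i k, ~ K i k -> row i (x k.+1) = row i (x k)) ->
  partially_asynchronous e K s B D ->
  strongly_critical f h W alpha (fun=> 0) xi ->
  ProperFilter U -> (forall r, x (k + r)%N @[k --> U] --> z r) ->
  (forall i r, (t <= r <= t + D)%N -> dot (err z xi i r) (err z xi i r) < v) ->
  \forall k \near \oo, forall i, dot (err x xi i k) (err x xi i k) <= v.
Proof.
move=> sp hn fin vs hold [_ fresh] sc UU xz win.
have : \forall k \near U, forall i (r : 'I_D.+1),
    dot (err x xi i (k + (t + r))) (err x xi i (k + (t + r))) <= v.
  apply: filter_forall => i; apply: filter_forall => r.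
  have wr : (t <= t + r <= t + D)%N by rewrite leq_addr leq_add2l -ltnS /=.
  exact: (cvgr_le _ (cvg_err (xi := xi) (i := i) _ (xz (t + r)%N)) _ (win i _ wr)).
move=> /filter_ex[k kP]; exists (k + t)%N => // l /= kl i; move: i l kl.
apply: (critical_bound_persists sp hn fin vs hold sc (leq_addr D (k + t))).
  move=> i j l Dl Kil eij; have [l1 l2] := fresh i j l eij Kil.
  by rewrite l2 andbT -(leq_add2r D); exact: leq_trans l1.
move=> i l /andP[l1 l2]; have lr : (l - (k + t) < D.+1)%N by lia.
by have := kP i (Ordinal lr); rewrite /= addnA subnKC.
Qed.

(** A limit trajectory is stationary from time [D] on, at a critical point: its
largest error relative to [xi] keeps reaching the value [V], so all its error
vectors coincide, and then its delayed Laplacian rows are the true ones. *)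
Lemma limit_trajectory_critical (R : realType) (n d : nat) (e : rel 'I_n.+1)
    (f : 'I_n.+1 -> 'rV[R]_d -> R) (h : 'I_n.+1 -> 'rV[R]_d -> \bar R)
    (W : 'M[R]_n.+1) (alpha : R) (gamma beta : 'I_n.+1 -> R)
    (K : 'I_n.+1 -> set nat) (s : 'I_n.+1 -> 'I_n.+1 -> nat -> nat) (B D : nat)
    (x z : nat -> 'M[R]_(n.+1, d)) (xi : 'M[R]_(n.+1, d)) (U : set_system nat) :
  stable_parameters e W alpha gamma beta -> connected_network e ->
  (forall i a, {for a, continuous (f i)}) -> (forall i, closed_fun (h i)) ->
  (forall i z, h i z != -oo%E) -> (forall i, h i (row i xi) \is a fin_num) ->
  variational_steps e f h W alpha gamma beta K s x ->
  (forall i k, ~ K i k -> row i (x k.+1) = row i (x k)) ->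
  partially_asynchronous e K s B D ->
  strongly_critical f h W alpha (fun=> 0) xi ->
  UltraFilter U -> \oo `<=` U -> (forall t, x (k + t)%N @[k --> U] --> z t) ->
  (forall i t, (D <= t)%N -> row i (z t) = row i (z D)) /\
  forall i, subdiff (fun y => ((f i y)%:E + h i y)%E) (row i (z D))
    (- (alpha^-1 *: laplacian_row W (z D) i)).
Proof.
move=> sp conn cf clh hn fin vs hold pa sc UU ooU xz.
have UP : ProperFilter U by exact: ultra_proper.
have [s' s'P] := ultralimit_delays UU pa.
pose K' i t := (D <= t)%N /\ \forall k \near U, K i (k + t)%N.
have often i t : exists2 t', (t <= t')%N & K' i t'.
  have [t' t't Ut'] := ultralimit_updates_often UU pa i (t + D).
  by exists t'; [lia|split => //; lia].
have vs' : variational_steps e f h W alpha gamma beta K' s' z.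
  apply: (variational_steps_limit UP cf clh hn vs xz) => i t [Dt Ut].
  have : \forall k \near U, forall j, e i j -> s i j (k + t)%N = (k + s' i j t)%N.
    apply: filter_forall => j; case: (boolP (e i j)) => [eij|_].
      by have [_ _] := s'P i j t Dt eij Ut; apply: filterS => k.
    by apply: filterE.
  by move=> Us; apply: filterS2 Ut Us => k.
have hold' i t : (D <= t)%N -> ~ K' i t -> row i (z t.+1) = row i (z t).
  move=> Dt nK; have [Ut|Ut] := in_ultra_setVsetC [set k | K i (k + t)%N] UU.
    by case: nK.
  have E : \forall k \near U, row i (x (k + t)%N) = row i (x (k + t.+1)%N).
    by apply: filterS Ut => k /hold; rewrite addnS.
  apply: (@cvg_unique _ _ (row i (x (k + t.+1)%N) @[k --> U])).
  - exact: norm_hausdorff.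
  - exact: cvg_row.
  - by apply: cvg_trans (near_eq_cvg E) _; exact: cvg_row.
have caus i j k : K i k -> e i j -> (s i j k <= k)%N.
  by move=> Kik eij; have [_ /(_ i j k eij Kik)[]] := pa.
have bnd := critical_initial_bound sp hn fin vs hold caus sc.
have [V [Vub Vlb]] := eventual_upper_bound (fun i k => dot_ge0 _) bnd.
have zV i t : dot (err z xi i t) (err z xi i t) <= V.
  apply/ler_addgt0Pr => eps eps0.
  apply: (cvgr_to_le (cvg_err (xi := xi) (i := i) _ (xz t))); apply: ooU.
  have [N _ HN] := Vub _ eps0; exists N => // k /= Nk.
  by apply: HN => /=; exact: leq_trans (leq_addr _ _).
(* Otherwise the maximum over one window of the limit would lie strictly below
   V, and so would all late errors of x. *)
have window t : exists i r, (t <= r)%N /\ dot (err z xi i r) (err z xi i r) = V.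
  apply: contrapT => no.
  have small i r : (t <= r)%N -> dot (err z xi i r) (err z xi i r) < V.
    move=> tr; rewrite lt_neqAle zV andbT; apply/eqP => E.
    by apply: no; exists i, r.
  pose F (q : 'I_n.+1 * 'I_D.+1) :=
    dot (err z xi q.1 (t + q.2)) (err z xi q.1 (t + q.2)).
  have V0 : 0 < V by apply: le_lt_trans (small ord0 t (leqnn t)); exact: dot_ge0.
  have wV : \big[Num.max/0]_q F q < V.
    by apply: bigmax_lt => // q _; apply: small; exact: leq_addr.
  have wv : \big[Num.max/0]_q F q < (\big[Num.max/0]_q F q + V) / 2 by lra.
  suff /Vlb : \forall k \near \oo, forall i,
      dot (err x xi i k) (err x xi i k) <= (\big[Num.max/0]_q F q + V) / 2 by lra.
  apply: (window_bound_eventually (t := t) sp hn fin vs hold pa sc UP xz).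
  move=> i r /andP[r1 r2]; have rD : (r - t < D.+1)%N by lia.
  apply: le_lt_trans wv; have := le_bigmax 0 F (i, Ordinal rD).
  by rewrite /F /= subnKC.
have fresh' i j t : e i j -> K' i t -> (t <= s' i j t + D)%N.
  by move=> eij [Dt Ut]; case: (s'P i j t Dt eij Ut).
have upd' i t : (D <= t)%N -> K' i t ->
    dot (err z xi i t.+1) (err z xi i t.+1) = V ->
    err z xi i t.+1 = err z xi i t /\
    forall j, e i j -> err z xi j (s' i j t) = err z xi i t.+1.
  move=> Dt K't EV.
  have [||E1 E2] := async_extremal_update sp hn fin vs' sc K't.
  - by rewrite EV.
  - by move=> j _; rewrite EV.
  - by split=> //; rewrite /err E1.
have hold'' i t : (D <= t)%N -> ~ K' i t -> err z xi i t.+1 = err z xi i t.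
  by move=> Dt nK; rewrite /err hold'.
have [c cE] := extremal_value_spreads (Q := fun u => dot u u = V)
  conn often fresh' hold'' upd' window.
have stat i t : (D <= t)%N -> row i (z t) = row i (z D).
  move=> Dt; apply: (@addIr _ (- row i xi)).
  by rewrite -/(err z xi i t) -/(err z xi i D) !cE.
(* An update after time 2D reads only values from the stationary phase. *)
split=> // i y; have [t DDt K't] := often i (D + D)%N.
have Dt : (D <= t)%N by lia.
have := vs' i t K't y; rewrite (stat i t.+1) ?leqW // (stat i t) //.
rewrite subrr dot0l mulr0 subr0 scaler0 add0r.
have -> // : delayed_laplacian_row e W s' z i t = laplacian_row W (z D) i.
have [avg _ _ _ _ _] := sp.
rewrite /laplacian_row (sum_neighbours avg) ?subrr //.
apply: eq_bigr => j eij; rewrite (stat i t) // (stat j (s' i j t)) //.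
by have := fresh' i j t eij K't; lia.
Qed.

(** Measured from the critical point [z D] instead of [xi], the errors of the
limit trajectory vanish, so those of [x] eventually fall below every positive
bound. *)
Lemma partially_async_converges (R : realType) (n d : nat) (e : rel 'I_n.+1)
    (f : 'I_n.+1 -> 'rV[R]_d -> R) (h : 'I_n.+1 -> 'rV[R]_d -> \bar R)
    (W : 'M[R]_n.+1) (alpha : R) (gamma beta : 'I_n.+1 -> R)
    (K : 'I_n.+1 -> set nat) (s : 'I_n.+1 -> 'I_n.+1 -> nat -> nat) (B D : nat)
    (x : nat -> 'M[R]_(n.+1, d)) (xi : 'M[R]_(n.+1, d)) :
  stable_parameters e W alpha gamma beta -> connected_network e ->
  (forall i a, {for a, continuous (f i)}) -> (forall i, closed_fun (h i)) ->
  (forall i, proper_fun (h i)) -> (forall i, h i (row i xi) \is a fin_num) ->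
  variational_steps e f h W alpha gamma beta K s x ->
  (forall i k, ~ K i k -> row i (x k.+1) = row i (x k)) ->
  partially_asynchronous e K s B D ->
  strongly_critical f h W alpha (fun=> 0) xi ->
  exists2 y, optimal f h W alpha y & x k @[k --> \oo] --> y.
Proof.
move=> sp conn cf clh ph fin vs hold pa sc.
have hn i a : h i a != -oo%E by exact: (ph i).1.
have caus i j k : K i k -> e i j -> (s i j k <= k)%N.
  by move=> Kik eij; have [_ /(_ i j k eij Kik)[]] := pa.
have bnd := critical_initial_bound sp hn fin vs hold caus sc.
have [U [UU ooU]] := ultraFilterLemma (eventually_filter).
have [z xz] := ultralimit_trajectory UU bnd.
have [stat sd] :=
  limit_trajectory_critical sp conn cf clh hn fin vs hold pa sc UU ooU xz.
have [[Wsym Wds _ _] _ a0 _ _ _] := sp.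
have opt := subdiff_optimal Wsym Wds a0 ph sd.
exists (z D) => //; apply: cvg_mx_sqdist => eps eps0.
apply: (window_bound_eventually (t := D) sp hn (optimal_fin ph opt) vs hold pa
  (subdiff_critical sd) (ultra_proper) xz).
by move=> i r /andP[Dr _]; rewrite /err stat // subrr dot0l.
Qed.

(** * The convergence theorem *)

Lemma minf_le (R : realType) (n : nat) (F : 'I_n.+1 -> R) i : minf F <= F i.
Proof. exact: bigmin_le. Qed.

Lemma minf_gt0 (R : realType) (n : nat) (F : 'I_n.+1 -> R) :
  (forall i, 0 < F i) -> 0 < minf F.
Proof. by move=> F0; rewrite /minf; elim/big_ind: _ => // a b; rewrite lt_min => -> ->. Qed.

(** The extended inverse of 0 is [+oo]: when [beta i + (1 - W i i) / alpha]
vanishes, [gamma i] is unconstrained and the product form holds trivially. *)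
Lemma step_bound_stable (R : realType) (n : nat) (e : rel 'I_n)
    (W : 'M[R]_n) (alpha : R) (gamma beta : 'I_n -> R) :
  irreflexive e -> averaging_matrix e W -> 0 < alpha ->
  (forall i, 0 <= beta i) ->
  (forall i, 0 < gamma i /\
     ((gamma i)%:E < ((beta i + (1 - W i i) / alpha)%:E)^-1)%E) ->
  stable_parameters e W alpha gamma beta.
Proof.
move=> irr avg a0 b0 sb; split=> // i; first by case: (sb i).
have [g0] := sb i; rewrite inver; case: eqVneq => [-> _|X0].
  by rewrite mulr0.
rewrite lte_fin => glt; have [_ [W0 W1 _] _ _] := avg.
have Wii : W i i <= 1.
  by rewrite -(W1 i) (bigD1 i) //= lerDl sumr_ge0.
rewrite -ltr_pdivlMr ?div1r // lt_neqAle eq_sym X0 addr_ge0 //.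
by rewrite divr_ge0 ?subr_ge0 // ltW.
Qed.

Theorem theorem1 (R : realType) (n d : nat)
    (e : rel 'I_n.+1) (W : 'M[R]_n.+1) (alpha : R)
    (f : 'I_n.+1 -> 'rV[R]_d -> R) (h : 'I_n.+1 -> 'rV[R]_d -> \bar R)
    (m : 'I_n.+1 -> nat -> 'rV[R]_d -> R)
    (gammak : 'I_n.+1 -> nat -> R) (gamma beta : 'I_n.+1 -> R)
    (K : 'I_n.+1 -> set nat) (s : 'I_n.+1 -> 'I_n.+1 -> nat -> nat)
    (x : nat -> 'M[R]_(n.+1, d))
    (network_e : network e) (connected_e : connected_network e)
    (averaging_W : averaging_matrix e W) (alpha_gt0 : 0 < alpha)
    (pcc_f : forall i, proper_closed_convex (fun z => (f i z)%:E))
    (pcc_h : forall i, proper_closed_convex (h i))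
    (diff_f : forall i z, differentiable (f i) z)
    (convex_m : forall i k, K i k -> cvx_fun (fun z => (m i k z)%:E))
    (beta_ge0 : forall i, 0 <= beta i)
    (model_m : forall i k z, K i k ->
       m i k z <= f i z <= m i k z + beta i / 2 * enorm (z - row i (x k)) ^+ 2)
    (has_optimal : exists y, optimal f h W alpha y)
    (delays_s : valid_delays e K s)
    (iterates_x : async_iterates e h W alpha m gammak K s x)
    (const_step : forall i k, gammak i k = gamma i)
    (step_bound : forall i, 0 < gamma i /\
       ((gamma i)%:E < ((beta i + (1 - W i i) / alpha)%:E)^-1)%E) :
  (forall B D : nat, partially_asynchronous e K s B D ->
     (exists2 y, optimal f h W alpha y & x k @[k --> \oo] --> y) /\
     (forall theta : 'I_n.+1 -> R,
        (forall i, 0 < theta i /\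
           strongly_convex (theta i) (fun z => ((f i z)%:E + h i z)%E)) ->
        let rho := (1 + minf (fun i => gamma i * theta i))^-1 in
        0 < rho < 1 /\
        forall xstar, optimal f h W alpha xstar ->
        forall i k,
          enorm (row i (x k) - row i xstar) ^+ 2 <=
          rho ^+ (k %/ (B + D + 1)) *
          \big[Num.max/0]_(j < n.+1)
             enorm (row j (x 0%N) - row j xstar) ^+ 2)) /\
  (totally_asynchronous e K s ->
   forall theta : 'I_n.+1 -> R,
     (forall i, 0 < theta i /\
        strongly_convex (theta i) (fun z => ((f i z)%:E + h i z)%E)) ->
     exists2 y, optimal f h W alpha y & x k @[k --> \oo] --> y).
Proof.
have [sym irr] := network_e; have [Wsym Wds _ _] := averaging_W.
have sp := step_bound_stable irr averaging_W alpha_gt0 beta_ge0 step_bound.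
have ph i : proper_fun (h i) by case: (pcc_h i).
have ch i : cvx_fun (h i) by case: (pcc_h i).
have clh i : closed_fun (h i) by case: (pcc_h i).
have cf i : cvx_fun (fun z => (f i z)%:E) by case: (pcc_f i).
have hn i z : h i z != -oo%E by exact: (ph i).1.
have g0 i : 0 < gamma i by case: (step_bound i).
have vs := async_iterates_variational convex_m ph ch model_m const_step g0
  iterates_x.
have hold i k : ~ K i k -> row i (x k.+1) = row i (x k).
  by case: (iterates_x i k).
have caus i j k : K i k -> e i j -> (s i j k <= k)%N.
  by move=> Kik; have [_] := delays_s i k Kik; exact.
pose rho theta : R := (1 + minf (fun i => gamma i * theta i))^-1.
have rho01 theta : (forall i, 0 < theta i) -> 0 < rho theta < 1.
  move=> t0; have : 0 < minf (fun i => gamma i * theta i).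
    by apply: minf_gt0 => i; rewrite mulr_gt0.
  by move=> m0; rewrite /rho invr_gt0 invf_lt1; [lra|lra].
have init xi (opt : optimal f h W alpha xi) i k :
    dot (err x xi i k) (err x xi i k)
    <= \big[Num.max/0]_j dot (err x xi j 0%N) (err x xi j 0%N).
  apply: (critical_initial_bound sp hn (optimal_fin ph opt) vs hold caus).
  exact: subdiff_critical (optimal_subdiff Wsym Wds alpha_gt0 cf ph ch opt).
have contr theta xi (opt : optimal f h W alpha xi) :
    (forall i, 0 < theta i /\
       strongly_convex (theta i) (fun z => ((f i z)%:E + h i z)%E)) ->
    forall i k c, K i k -> dot (err x xi i k) (err x xi i k) <= c ->
    (forall j, e i j ->
       dot (err x xi j (s i j k)) (err x xi j (s i j k)) <= c) ->
    dot (err x xi i k.+1) (err x xi i k.+1) <= rho theta * c.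
  move=> th i k c Kik ci cj; have fin := optimal_fin ph opt.
  have sc := strongly_convex_critical (fun i => (th i).2) fin
    (optimal_subdiff Wsym Wds alpha_gt0 cf ph ch opt).
  have H := async_error_contraction sp hn fin vs sc Kik ci cj.
  have m0 : 0 < minf (fun i => gamma i * theta i).
    by apply: minf_gt0 => i'; rewrite mulr_gt0 //; case: (th i').
  have mi := minf_le (fun i => gamma i * theta i) i.
  rewrite mulrC ler_pdivlMr; last by lra.
  apply: le_trans H; rewrite mulrC ler_wpM2r ?dot_ge0 // lerD2l.
  exact: mi.
have holdd xi i k : ~ K i k -> dot (err x xi i k.+1) (err x xi i k.+1)
    = dot (err x xi i k) (err x xi i k).
  by move=> nK; rewrite /err hold.
have [xi opt] := has_optimal.
split=> [B D pa|ta theta th]; last first.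
  exists xi => //; apply: cvg_mx_sqdist => eps eps0.
  set c := \big[Num.max/0]_j dot (err x xi j 0%N) (err x xi j 0%N).
  have rate := totally_async_rate ta (holdd xi) (contr theta xi opt th)
    (init xi opt).
  have /andP[r0 r1] := rho01 theta (fun i => (th i).1).
  have : rho theta ^+ q * c @[q --> \oo] --> 0 * c.
    by apply: cvgMl; apply: cvg_expr; rewrite gtr0_norm.
  rewrite mul0r => /cvgr_le /(_ eps eps0) /filter_ex[q qP].
  by apply: filterS (rate q) => k Hk i; exact: le_trans (Hk i) qP.
split.
  apply: (partially_async_converges sp connected_e _ clh ph
    (optimal_fin ph opt) vs hold pa).
    by move=> i a; exact: differentiable_continuous.
  exact: subdiff_critical (optimal_subdiff Wsym Wds alpha_gt0 cf ph ch opt).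
move=> theta th; have rho_in := rho01 theta (fun i => (th i).1).
split=> // xstar optx i k; have /andP[r0 _] := rho_in.
rewrite enorm_sq; under eq_bigr do rewrite enorm_sq.
exact: (partially_async_rate pa (ltW r0) (holdd xstar)
  (contr theta xstar optx th) (init xstar optx)).
Qed.
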